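(* Let $\lambda\in\check P$ and $\alpha\in\Phi^+$. (1) If $\langle\lambda,\alpha\rangle>0$, then for any integer $0<k\le\langle\lambda,\alpha\rangle$, $$(e_{\check\alpha})^k\cdot v_{\varpi(\lambda)}\ne0\quad\text{and}\quad \mathtt{p}\big(\mathrm{wt}((e_{\check\alpha})^k\cdot v_{\varpi(\lambda)})\big)=\lambda-k\check\alpha.$$ (2) If $\langle\lambda,\alpha\rangle<-1$, then for any integer $0<k<-\langle\lambda,\alpha\rangle$, $$(e_{-\check\alpha+r_\alpha\check\delta})^k\cdot v_{\varpi(\lambda)}\ne0\quad\text{and}\quad \mathtt{p}\big(\mathrm{wt}((e_{-\check\alpha+r_\alpha\check\delta})^k\cdot v_{\varpi(\lambda)})\big)=\lambda+k\check\alpha.$$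
   Context: $\mathfrak{g}$ is the Lie algebra of a simple algebraic group $G$ over $\mathbb{C}$ of adjoint type, with maximal torus $T$, roots $\Phi$, positive roots $\Phi^+$, Weyl group $W$, simple roots and coroots $\alpha_i,\check\alpha_i$ ($i\in I$), coweight lattice $\check P=X_*(T)$ and coroot lattice $\check Q$. Let $\tilde{\mathfrak{g}}$ be the (untwisted) affine Kac–Moody algebra of $\mathfrak{g}$, with vertex set $\hat I=I\sqcup\{0\}$ of its Dynkin diagram $\hat\Gamma$, and Kac labels $a_i$ ($a_0=1$; the highest root is $\theta=\sum_{i\in I}a_i\alpha_i$). ${}^L\tilde{\mathfrak{g}}$ is the affine Kac–Moody algebra whose Dynkin diagram is dual to $\hat\Gamma$ (transposed Cartan matrix), and ${}^L\mathfrak{g}$ is its simple subalgebra attached to the vertices $I$. Its Cartan subalgebra is ${}^L\tilde{\mathfrak{h}}={}^L\mathfrak{h}\oplus\mathbb{C}\check c\oplus\mathbb{C}\check d$ ($\check c$ the canonical central element, $\check d$ the degree operator), and ${}^L\tilde{\mathfrak{h}}^*={}^L\mathfrak{h}^*\oplus\mathbb{C}\check\Lambda_0\oplus\mathbb{C}\check\delta$, where $\check\Lambda_0$ is the fundamental weight attached to $0$, and $\check\delta$ vanishes on ${}^L\mathfrak{h}$ and $\check c$ and satisfies $\langle\check\delta,\check d\rangle=1$. The simple roots of ${}^L\tilde{\mathfrak{g}}$ are the simple coroots $\check\alpha_i$ of $\tilde{\mathfrak{g}}$ and its simple coroots are the simple roots $\alpha_i$ of $\tilde{\mathfrak{g}}$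 ($i\in\hat I$); $\check Q\subset\check P\subset{}^L\mathfrak{h}^*$ are identified with the root and weight lattices of ${}^L\mathfrak{g}$. The real roots of ${}^L\tilde{\mathfrak{g}}$ are $\check\alpha+kr_\alpha\check\delta$ ($\alpha\in\Phi$, $k\in\mathbb{Z}$), where $r_\alpha=2/(\alpha|\alpha)$ with the form normalized so that long roots of $\mathfrak{g}$ have square length $2$ (so $r_\alpha=1$ if $\mathfrak{g}$ is simply-laced or $\alpha$ is long, $r_\alpha=2$ for short roots in types $B_n,C_n,F_4$, $r_\alpha=3$ for short roots in type $G_2$). For a real root $\beta$ of ${}^L\tilde{\mathfrak{g}}$, $e_\beta$ is a (nonzero) root vector of root $\beta$. $\hat M=\{i\in\hat I:a_i=1\}$; for $\kappa\in\hat M$, $\check\omega_\kappa$ is the fundamental coweight of $\mathfrak{g}$ attached to $\kappa$ if $\kappa\ne0$, and $\check\omega_0=0$. Put $\check Q_\kappa=\check Q-\check\omega_\kappa$; $\check P$ is the disjoint union of the $\check Q_\kappa$, $\kappa\in\hat M$. Let $\mathscr{H}_\kappa$ be the irreducible integrable ${}^L\tilde{\mathfrak{g}}$-module of highest weight $\check\Lambda_\kappa=\check\Lambda_0+\check\omega_\kappa$. For $\lambda\in\check Q_\kappa$ set $\varpi(\lambda)=\check\Lambda_0-\lambda-\frac{(\lambda|\lambda)-(\check\omega_\kappa|\check\omega_\kappa)}{2}\check\delta$, where $(\cdot|\cdot)$ on $\check P$ is the $W$-invariant form with $(\check\theta|\check\theta)=2$; this weight is in the Weyl group orbit of $\check\Lambda_\kappa$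 (it equals $\tau_{-\lambda-\check\omega_\kappa}(\check\Lambda_\kappa)$ for the translation $\tau_{-\lambda-\check\omega_\kappa}$ in the affine Weyl group $\check Q\rtimes W$ of ${}^L\tilde{\mathfrak{g}}$), and $v_{\varpi(\lambda)}\in\mathscr{H}_\kappa$ is a nonzero (extremal) vector of weight $\varpi(\lambda)$. $\mathrm{wt}(v)$ is the weight of a weight vector $v$. Every weight of $\mathscr{H}_\kappa$ has the form $\check\Lambda_0-\nu+m\check\delta$ with $\nu\in\check P$, $m\in\mathbb{Z}$, and $\mathtt{p}$ sends such a weight to $\nu$. *)

(* Defs.v *)
From HB Require Import structures.
From mathcomp Require Import all_boot all_order all_algebra.
From mathcomp Require Import reals ring.
From mathcomp Require Export complex.

Set Implicit Arguments.
Unset Strict Implicit.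
Unset Printing Implicit Defensive.

Import Order.TTheory GRing.Theory Num.Theory.
Local Open Scope ring_scope.

Record lieAlgebra (K : fieldType) := LieAlgebra {
  lie_sort :> lmodType K;
  lie_br : lie_sort -> lie_sort -> lie_sort;
  lie_linearl : forall y, linear (fun x => lie_br x y);
  lie_linearr : forall x, linear (lie_br x);
  lie_alt : forall x, lie_br x x = 0;
  lie_jacobi : forall x y z,
    lie_br x (lie_br y z) + lie_br y (lie_br z x) + lie_br z (lie_br x y) = 0
}.

Record lieModule (K : fieldType) (L : lieAlgebra K) := LieModule {
  lmodule_sort :> lmodType K;
  lact : L -> lmodule_sort -> lmodule_sort;
  lact_linearl : forall v, linear (lact^~ v);
  lact_linearr : forall x, linear (lact x);
  lact_br : forall x y v,
    lact (lie_br x y) v = lact x (lact y v) - lact y (lact x v)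
}.

Section Subobjects.
Variables (K : fieldType) (L : lieAlgebra K).

Definition is_subspace (V : lmodType K) (S : V -> Prop) : Prop :=
  S 0 /\ forall a u v, S u -> S v -> S (a *: u + v).

Definition is_subalgebra (S : L -> Prop) : Prop :=
  is_subspace S /\ forall x y, S x -> S y -> S (lie_br x y).

Definition is_ideal (S : L -> Prop) : Prop :=
  is_subspace S /\ forall x y, S y -> S (lie_br x y).

Definition is_submodule (V : lieModule L) (S : V -> Prop) : Prop :=
  is_subspace S /\ forall x v, S v -> S (lact x v).

Definition irreducible_module (V : lieModule L) : Prop :=
  (exists v : V, v != 0) /\
  forall S : V -> Prop, is_submodule S ->
    (forall v, S v -> v = 0) \/ (forall v, S v).

End Subobjects.

Record realization (K : fieldType) (m : nat) (A : 'M[int]_m) := Realization {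
  cartan : vectType K;
  scoroot : 'I_m -> cartan;
  sroot : 'I_m -> cartan -> K;
  sroot_linear : forall j, linear_for *%R (sroot j);
  scoroot_free : forall c : 'I_m -> K,
    \sum_i c i *: scoroot i = 0 -> forall i, c i = 0;
  sroot_free : forall c : 'I_m -> K,
    (forall x, \sum_j c j * sroot j x = 0) -> forall j, c j = 0;
  sroot_scoroot : forall i j, sroot j (scoroot i) = (A i j)%:~R;
  cartan_dim :
    (\dim {:cartan} + \rank (map_mx (intr : int -> K) A) = m.*2)%N
}.

(* Kac, Infinite dimensional Lie algebras, 1.1-1.4: g(A) is, up to           *)
(* isomorphism, the Lie algebra generated by h and elements e_i, f_i subject *)
(* to the relations below, in which h embeds and which has no nonzero ideal  *)
(* meeting h trivially.                                                      *)
Record kacMoody (K : fieldType) (m : nat) (A : 'M[int]_m)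
    (h : realization K A) := KacMoody {
  km_lie :> lieAlgebra K;
  km_h : cartan h -> km_lie;
  km_e : 'I_m -> km_lie;
  km_f : 'I_m -> km_lie;
  km_h_linear : linear km_h;
  km_h_inj : injective km_h;
  km_hh : forall x y, lie_br (km_h x) (km_h y) = 0;
  km_he : forall x i, lie_br (km_h x) (km_e i) = sroot i x *: km_e i;
  km_hf : forall x i, lie_br (km_h x) (km_f i) = - sroot i x *: km_f i;
  km_ef : forall i j, lie_br (km_e i) (km_f j) =
    if i == j then km_h (scoroot h i) else 0;
  km_generated : forall S : km_lie -> Prop, is_subalgebra S ->
    (forall x, S (km_h x)) -> (forall i, S (km_e i)) ->
    (forall i, S (km_f i)) -> forall y, S y;
  km_no_ideal : forall S : km_lie -> Prop, is_ideal S ->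
    (forall x, S (km_h x) -> km_h x = 0) -> forall y, S y -> y = 0
}.

Section Weights.
Variables (K : fieldType) (m : nat) (A : 'M[int]_m) (h : realization K A).
Variable g : kacMoody h.

Definition root_vector (beta : cartan h -> K) (x : g) : Prop :=
  x != 0 /\ forall t, lie_br (km_h g t) x = beta t *: x.

Definition weight_vector (V : lieModule g) (mu : cartan h -> K) (v : V) :
    Prop :=
  v != 0 /\ forall t, lact (km_h g t) v = mu t *: v.

Definition locally_nilpotent (V : lieModule g) (x : g) : Prop :=
  forall v : V, exists N, iter N (lact x) v = 0.

Definition h_diagonalizable (V : lieModule g) : Prop :=
  forall v : V, exists s : seq V,
    v = \sum_(u <- s) u /\
    forall u, u \in s -> exists mu : cartan h -> K, weight_vector mu u.

Definition integrable_module (V : lieModule g) : Prop :=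
  h_diagonalizable V /\
  forall i, locally_nilpotent V (km_e g i) /\ locally_nilpotent V (km_f g i).

Definition highest_weight_module (V : lieModule g) (mu : cartan h -> K) :
    Prop :=
  exists v : V, [/\ weight_vector mu v,
    forall i, lact (km_e g i) v = 0 &
    forall S : V -> Prop, is_submodule S -> S v -> forall u, S u].

End Weights.

Arguments root_vector {K m A h} g beta x.
Arguments weight_vector {K m A h} g {V} mu v.
Arguments integrable_module {K m A h} g V.
Arguments highest_weight_module {K m A h} g V mu.

Definition ipair (n : nat) (x a : 'rV[int]_n) : int := (x *m a^T) 0 0.

(* The group being adjoint, its character lattice X^*(T) is the root lattice *)
(* with the simple roots as a basis, and X_*(T) is the coweight lattice with *)
(* the dual basis of fundamental coweights.  Characters are written in the   *)
(* first basis and cocharacters in the second, so that the pairing is ipair. *)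
(* The axioms are those of a reduced irreducible root datum with a base.     *)
Record rootDatum (n : nat) := RootDatum {
  roots : seq 'rV[int]_n;
  coroot : 'rV[int]_n -> 'rV[int]_n;
  rank_gt0 : (0 < n)%N;
  coroot_inj : forall a b, a \in roots -> b \in roots ->
    coroot a = coroot b -> a = b;
  coroot_root : forall a, a \in roots -> ipair (coroot a) a = 2;
  root_refl : forall a b, a \in roots -> b \in roots ->
    b - ipair (coroot a) b *: a \in roots;
  coroot_refl : forall a b, a \in roots -> b \in roots ->
    exists2 c, c \in roots &
      coroot c = coroot b - ipair (coroot b) a *: coroot a;
  root_reduced : forall a, a \in roots -> a *+ 2 \notin roots;
  simple_is_root : forall i, delta_mx 0 i \in roots;
  root_pos_or_neg : forall a, a \in roots ->
    (forall i, 0 <= a 0 i) \/ (forall i, a 0 i <= 0);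
  root_irreducible : forall P : pred 'rV[int]_n,
    (exists2 a, a \in roots & P a) ->
    (forall a b, a \in roots -> b \in roots -> P a -> ~~ P b ->
       ipair (coroot a) b = 0) ->
    forall a, a \in roots -> P a
}.

Section FiniteData.
Variables (n : nat) (D : rootDatum n).

Definition is_pos_root (a : 'rV[int]_n) : Prop :=
  a \in roots D /\ forall i, 0 <= a 0 i.

Definition simple_root (i : 'I_n) : 'rV[int]_n := delta_mx 0 i.

Definition highest_root (theta : 'rV[int]_n) : Prop :=
  theta \in roots D /\ forall a, a \in roots D -> forall i, a 0 i <= theta 0 i.

Definition in_coroot_lattice (x : 'rV[int]_n) : Prop :=
  exists c : 'I_n -> int, x = \sum_i c i *: coroot D (simple_root i).

Definition gram (B : 'M[rat]_n) (x y : 'rV[int]_n) : rat :=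
  (map_mx intr x *m B *m (map_mx intr y)^T) 0 0.

(* Invariance under the reflections, which generate the Weyl group.          *)
Definition invariant_root_form (B : 'M[rat]_n) : Prop :=
  B^T = B /\ forall a, a \in roots D -> forall x y,
    gram B (x - ipair (coroot D a) x *: a) (y - ipair (coroot D a) y *: a)
    = gram B x y.

Definition invariant_coweight_form (B : 'M[rat]_n) : Prop :=
  B^T = B /\ forall a, a \in roots D -> forall x y,
    gram B (x - ipair x a *: coroot D a) (y - ipair y a *: coroot D a)
    = gram B x y.

Definition long_root (B : 'M[rat]_n) (a : 'rV[int]_n) : Prop :=
  a \in roots D /\ forall b, b \in roots D -> gram B b b <= gram B a a.

Definition normalized_root_form (B : 'M[rat]_n) : Prop :=
  invariant_root_form B /\ forall a, long_root B a -> gram B a a = 2.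

Definition normalized_coweight_form (theta : 'rV[int]_n) (B : 'M[rat]_n) :
    Prop :=
  invariant_coweight_form B /\
  gram B (coroot D theta) (coroot D theta) = 2.

Definition rlength (B : 'M[rat]_n) (a : 'rV[int]_n) : rat := 2 / gram B a a.

(* The affine diagram has vertex set 'I_n.+1, with 0 the affine vertex and   *)
(* lift ord0 i the vertex i of the finite diagram.  Restricted to the finite *)
(* Cartan subalgebra, the affine simple root is - theta, and modulo the      *)
(* centre the affine simple coroot is minus the coroot of theta.             *)
Definition aff_root (theta : 'rV[int]_n) (i : 'I_n.+1) : 'rV[int]_n :=
  if unlift ord0 i is Some j then simple_root j else - theta.

Definition aff_coroot (theta : 'rV[int]_n) (i : 'I_n.+1) : 'rV[int]_n :=
  if unlift ord0 i is Some j then coroot D (simple_root j)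
  else - coroot D theta.

Definition affine_cartan (theta : 'rV[int]_n) : 'M[int]_n.+1 :=
  \matrix_(i, j) ipair (aff_coroot theta i) (aff_root theta j).

Definition kac_label (theta : 'rV[int]_n) (i : 'I_n.+1) : int :=
  if unlift ord0 i is Some j then theta 0 j else 1.

Definition fund_coweight (i : 'I_n.+1) : 'rV[int]_n :=
  if unlift ord0 i is Some j then delta_mx 0 j else 0.

Definition in_coroot_coset (i : 'I_n.+1) (x : 'rV[int]_n) : Prop :=
  in_coroot_lattice (x + fund_coweight i).

End FiniteData.

Section DualCartan.
Variables (K : fieldType) (n : nat).

(* (x, a, b) stands for x + a c + b d, with x in the finite part, written in *)
(* the basis of its simple coroots (the simple roots of the root datum).     *)
Definition dcartan : vectType K := ('rV[K]_n * K^o * K^o)%type.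

(* (y, a, b) stands for y + a Lambda_0 + b delta, with y in the dual basis.  *)
Definition dweight : vectType K := ('rV[K]_n * K^o * K^o)%type.

Definition weval (mu : dweight) (x : dcartan) : K :=
  (mu.1.1 *m x.1.1^T) 0 0 + mu.1.2 * x.1.2 + mu.2 * x.2.

Definition fin_cartan (a : 'rV[int]_n) : dcartan := (map_mx intr a, 0, 0).
Definition cc : dcartan := (0, 1, 0).

Definition fin_weight (y : 'rV[int]_n) : dweight := (map_mx intr y, 0, 0).
Definition Lambda0 : dweight := (0, 1, 0).
Definition ddelta : dweight := (0, 0, 1).

(* A weight Lambda_0 - nu + m delta is sent to nu.                           *)
Definition pweight (mu : dweight) : 'rV[K]_n := - mu.1.1.

Variables (D : rootDatum n) (theta : 'rV[int]_n).

Definition dual_scoroot (i : 'I_n.+1) : dcartan :=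
  if unlift ord0 i is Some j then fin_cartan (simple_root j)
  else cc - fin_cartan theta.

Definition dual_sroot (i : 'I_n.+1) : dweight :=
  if unlift ord0 i is Some j then fin_weight (coroot D (simple_root j))
  else ddelta - fin_weight (coroot D theta).

End DualCartan.

Section DualRealization.
Variables (n : nat) (D : rootDatum n).

Lemma ipairE (x a : 'rV[int]_n) : ipair x a = \sum_k x 0 k * a 0 k.
Proof. by rewrite /ipair mxE; apply: eq_bigr => k _; rewrite mxE. Qed.

Lemma ipairDl x y a : ipair (x + y : 'rV[int]_n) a = ipair x a + ipair y a.
Proof. by rewrite /ipair mulmxDl mxE. Qed.

Lemma ipairDr x a b : ipair x (a + b : 'rV[int]_n) = ipair x a + ipair x b.
Proof. by rewrite /ipair linearD mulmxDr mxE. Qed.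

Lemma ipairZl c x a : ipair (c *: x : 'rV[int]_n) a = c * ipair x a.
Proof. by rewrite /ipair -scalemxAl mxE. Qed.

Lemma ipairZr c x a : ipair x (c *: a : 'rV[int]_n) = c * ipair x a.
Proof. by rewrite /ipair linearZ -scalemxAr mxE. Qed.

Lemma ipair_delta x (i : 'I_n) : ipair x (delta_mx 0 i) = x 0 i.
Proof.
rewrite ipairE (bigD1 i) //= big1 ?addr0 => [|k ki]; rewrite mxE !eqxx ?mulr1 //=.
by rewrite (negPf ki) mulr0.
Qed.

Let refl a b := b - ipair (coroot D a) b *: a.
Let corefl a x := x - ipair x a *: coroot D a.
Let B x y := \sum_(c <- undup (roots D)) ipair x c * ipair y c.

Let ipair_corefl a x c : ipair (corefl a x) c = ipair x (refl a c).
Proof.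
by rewrite ipairDl ipairDr -!scaleNr ipairZl ipairZr !mulNr mulrC.
Qed.

Let reflK a : a \in roots D -> involutive (refl a).
Proof.
move=> aR c; rewrite /refl ipairDr -scaleNr ipairZr coroot_root //.
set k := ipair _ _; rewrite -addrA -scaleNr -scalerDl.
suff -> : - k - (k + - k * 2) = 0 by rewrite scale0r addr0.
ring.
Qed.

Let refl_perm a : a \in roots D ->
  perm_eq [seq refl a c | c <- undup (roots D)] (undup (roots D)).
Proof.
move=> aR; apply: uniq_perm; first 2 last.
- move=> c; apply/mapP/idP => [[b]|]; rewrite !mem_undup.
    by move=> bR ->; exact: root_refl.
  by move=> cR; exists (refl a c); rewrite ?mem_undup ?reflK //; exact: root_refl.
- by rewrite map_inj_uniq ?undup_uniq //; exact: inv_inj (reflK aR).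
- exact: undup_uniq.
Qed.

Let B_inv a x y : a \in roots D -> B (corefl a x) (corefl a y) = B x y.
Proof.
move=> aR; rewrite /B -[RHS](perm_big _ (refl_perm aR)) big_map.
by apply: eq_bigr => c _; rewrite !ipair_corefl.
Qed.

Let BDr x y z : B x (y + z) = B x y + B x z.
Proof. by rewrite -big_split; apply: eq_bigr => c _; rewrite ipairDl mulrDr. Qed.

Let BZr k x y : B x (k *: y) = k * B x y.
Proof. by rewrite mulr_sumr; apply: eq_bigr => c _; rewrite ipairZl mulrCA. Qed.

Let BC x y : B x y = B y x.
Proof. by apply: eq_bigr => c _; rewrite mulrC. Qed.

Let B_coroot a y : a \in roots D ->
  B (coroot D a) y *+ 2 = ipair y a * B (coroot D a) (coroot D a).
Proof.
move=> aR; have := B_inv (coroot D a) y aR.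
rewrite {1}/corefl coroot_root //.
have -> : coroot D a - 2 *: coroot D a = (-1) *: coroot D a.
  by rewrite scaler_nat mulr2n opprD addrA subrr add0r scaleN1r.
rewrite BC BZr BC /corefl BDr -scaleNr BZr mulN1r mulNr opprB => E.
by rewrite mulr2n -{2}E addrC subrK.
Qed.

Let B_gt0 a : a \in roots D -> 0 < B (coroot D a) (coroot D a).
Proof.
move=> aR; rewrite /B (perm_big _ (perm_to_rem (s := undup (roots D)) (x := a) _));
  last by rewrite mem_undup.
rewrite big_cons coroot_root // ltr_wpDr //.
by apply: sumr_ge0 => c _; rewrite -expr2 sqr_ge0.
Qed.

Lemma simple_coroots_free (K : numFieldType) (c : 'I_n -> K) :
  \sum_j c j *: map_mx intr (coroot D (simple_root j)) = 0 :> 'rV[K]_n ->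
  forall j, c j = 0.
Proof.
move=> c0 k; pose e : 'rV[int]_n := delta_mx 0 k.
have sR j : simple_root j \in roots D by exact: simple_is_root.
have Bc x : B e x = \sum_l x 0 l * B e (delta_mx 0 l).
  by rewrite {1}(row_sum_delta x) (big_morph (B e) (BDr e) (id1 := 0));
    [apply: eq_bigr => l _; rewrite BZr | rewrite -[X in B e X](scale0r (0 : 'rV[int]_n)) BZr mul0r].
have : \sum_j c j * (B e (coroot D (simple_root j)))%:~R = 0.
  transitivity (\sum_l (B e (delta_mx 0 l))%:~R *
     (\sum_j c j *: map_mx intr (coroot D (simple_root j)) : 'rV[K]_n) 0 l).
    under [RHS]eq_bigr do rewrite summxE mulr_sumr.
    rewrite exchange_big; apply: eq_bigr => j _ /=.
    rewrite Bc rmorph_sum mulr_sumr; apply: eq_bigr => l _ /=.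
    by rewrite !mxE rmorphM /= mulrA mulrC.
  by rewrite c0; apply: big1 => l _; rewrite mxE mulr0.
move/(congr1 (fun x => x *+ 2)); rewrite mul0rn -sumrMnl (bigD1 k) //= big1 ?addr0.
  rewrite -mulrnAr -rmorphMn /= BC B_coroot ?sR // ipair_delta mxE !eqxx mul1r.
  by move/eqP; rewrite mulf_eq0 intr_eq0 (gt_eqF (B_gt0 (sR k))) orbF => /eqP.
move=> j jk; rewrite -mulrnAr -rmorphMn /= BC B_coroot ?sR // ipair_delta mxE.
by rewrite (negPf jk) andbF mul0r mulr0.
Qed.

Variables (K : numFieldType) (theta : 'rV[int]_n).

Lemma weval_linear (mu : dweight K n) : linear_for *%R (weval mu).
Proof.
move=> k [[x a] b] [[x' a'] b'].
rewrite /weval /= linearD linearZ /= mulmxDr -scalemxAr !mxE.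
rewrite /GRing.scale /=; ring.
Qed.

Lemma dual_sroot_linear j : linear_for *%R (weval (dual_sroot K D theta j)).
Proof. exact: weval_linear. Qed.

Lemma dual_scorootE i : dual_scoroot K theta i =
  (map_mx intr (aff_root theta i), (unlift ord0 i == None)%:R, 0).
Proof.
rewrite /dual_scoroot /aff_root; case: unlift => [j|] //=.
transitivity ((0 - map_mx intr theta, 1 - 0, 0 - 0) : dcartan K n) => //.
by rewrite map_mxN !subr0 sub0r.
Qed.

Lemma dual_srootE i : dual_sroot K D theta i =
  (map_mx intr (aff_coroot D theta i), 0, (unlift ord0 i == None)%:R).
Proof.
rewrite /dual_sroot /aff_coroot; case: unlift => [j|] //=.
transitivity ((0 - map_mx intr (coroot D theta), 0 - 0, 1 - 0) : dweight K n) => //.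
by rewrite map_mxN !subr0 sub0r.
Qed.

Lemma dual_pairing i j :
  weval (dual_sroot K D theta j) (dual_scoroot K theta i) =
  ((affine_cartan D theta)^T i j)%:~R.
Proof.
rewrite dual_scorootE dual_srootE /weval /= mul0r mulr0 !addr0 !mxE /ipair mxE.
by rewrite rmorph_sum; apply: eq_bigr => k _; rewrite /= !mxE rmorphM.
Qed.

Lemma dual_scoroot_free (c : 'I_n.+1 -> K) :
  \sum_i c i *: dual_scoroot K theta i = 0 -> forall i, c i = 0.
Proof.
move=> c0.
have c00 : c ord0 = 0.
  have := congr1 (fun x : dcartan K n => x.1.2) c0.
  rewrite (raddf_sum (fst : dcartan K n -> _)) (raddf_sum snd) /=.
  rewrite big_ord_recl big1 ?addr0 => [|i _]; rewrite dual_scorootE ?unlift_none ?liftK /=.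
    by rewrite /GRing.scale /= mulr1.
  by rewrite scaler0.
move=> i; case: (unliftP ord0 i) => [j|] -> //.
have := congr1 (fun x : dcartan K n => x.1.1 0 j) c0.
rewrite (raddf_sum (fst : dcartan K n -> _)) (raddf_sum fst) /= summxE.
rewrite big_ord_recl c00 scale0r !mxE add0r (bigD1 j) //= big1 ?addr0 => [|k kj];
  rewrite dual_scorootE /aff_root liftK /= !mxE eqxx /=.
  by rewrite eqxx mulr1.
by rewrite eq_sym (negPf kj) mulr0.
Qed.

Lemma dual_sroot_free (c : 'I_n.+1 -> K) :
  (forall x, \sum_j c j * weval (dual_sroot K D theta j) x = 0) ->
  forall j, c j = 0.
Proof.
move=> cx.
have c00 : c ord0 = 0.
  have := cx (0, 0, 1); rewrite big_ord_recl big1 => [|i _];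
    rewrite dual_srootE ?unlift_none ?liftK /weval /= trmx0 mulmx0 mxE !mul0r.
    by rewrite !add0r mul1r mulr1 addr0.
  by rewrite !addr0 mulr0.
move=> i; case: (unliftP ord0 i) => [j|] -> //.
apply: (simple_coroots_free (c := fun j => c (lift ord0 j))).
apply/rowP => k; rewrite mxE summxE -[RHS](cx (delta_mx 0 k, 0, 0)).
rewrite big_ord_recl c00 mul0r add0r; apply: eq_bigr => l _.
rewrite dual_srootE /weval /= /aff_coroot liftK !mulr0 !addr0 !mxE.
rewrite (bigD1 k) //= big1 ?addr0 => [|h hk]; rewrite !mxE !eqxx /= ?mulr1 //.
by rewrite (negPf hk) mulr0.
Qed.

Lemma dual_affine_rank : \rank (map_mx (intr : int -> K)
  (affine_cartan D theta)^T) = n.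
Proof.
pose C : 'M[K]_(n.+1, n) := \matrix_(i, k) ((aff_coroot D theta i) 0 k)%:~R.
pose A : 'M[K]_(n.+1, n) := \matrix_(j, k) ((aff_root theta j) 0 k)%:~R.
pose C1 : 'M[K]_n := \matrix_(i, k) ((coroot D (simple_root i)) 0 k)%:~R.
have AE : map_mx intr (affine_cartan D theta) = C *m A^T :> 'M[K]_n.+1.
  apply/matrixP => i j; rewrite !mxE ipairE rmorph_sum; apply: eq_bigr => k _.
  by rewrite /= !mxE rmorphM.
rewrite -map_trmx mxrank_tr AE.
have A1 : rowsub (lift ord0) A = 1%:M.
  apply/matrixP => i j; rewrite !mxE /aff_root liftK !mxE eqxx /= eq_sym.
  by case: eqP.
have C1E : rowsub (lift ord0) C = C1.
  by apply/matrixP => i j; rewrite !mxE /aff_coroot liftK.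
have C1free : row_free C1.
  rewrite -kermx_eq0; apply/rowV0P => v /sub_kermxP vC.
  apply/rowP => j; rewrite [RHS]mxE.
  apply: (simple_coroots_free (c := fun j => v 0 j)).
  rewrite -[RHS]vC; apply/rowP => k; rewrite summxE mxE.
  by apply: eq_bigr => i _; rewrite !mxE.
have A1f : row_free A^T.
  apply/row_freeP; exists (colsub (lift ord0) 1%:M).
  by rewrite -[colsub _ _]trmxK -trmx_mul trmx_mxsub trmx1 mul_rowsub_mx mul1mx
    A1 trmx1.
rewrite mxrankMfree //; apply/eqP; rewrite eqn_leq rank_leq_col /=.
rewrite -{1}(eqP C1free) -C1E; apply: mxrankS.
by rewrite -[C in rowsub _ C]mul1mx -mul_rowsub_mx submxMl.
Qed.

Lemma dual_affine_dim : (\dim {:dcartan K n} + \rank (map_mx (intr : int -> K)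
  (affine_cartan D theta)^T) = (n.+1).*2)%N.
Proof.
have -> : \dim {:dcartan K n} = n.+2.
  by transitivity (1 * n + 1 + 1)%N; [rewrite dimvf|rewrite mul1n !addn1].
by rewrite dual_affine_rank -addnn addSn addnS.
Qed.

Definition dual_affine : realization K (affine_cartan D theta)^T :=
  Realization dual_sroot_linear dual_scoroot_free dual_sroot_free
    dual_pairing dual_affine_dim.

Definition varpi (Bco : 'M[rat]_n) (i : 'I_n.+1) (x : 'rV[int]_n) :
    dweight K n :=
  Lambda0 K n - fin_weight K x -
  ratr ((gram Bco x x - gram Bco (fund_coweight i) (fund_coweight i)) / 2) *:
    ddelta K n.

End DualRealization.

(* Main.v *)
(* For a real root b of the dual affine algebra there is an sl2-triple
   (e, b^, f) with e and f locally nilpotent on H and with root space C e.  On a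
   vector v of weight mu with mu(b^) = - p <= 0, local nilpotency of f makes
   e^p, hence every e^k with k <= p, injective.  For b = alpha^ one has
   b^ = alpha and p = <lambda, alpha>; for b = - alpha^ + r_alpha delta one has
   b^ = - alpha + c, and as the level is 1, p = - <lambda, alpha> - 1.

   The triples are obtained from those of the simple roots: the automorphisms
   exp(e) exp(-f) exp(e) show that the set of pairs (b, b^) admitting such a
   triple is stable under reflections.  Finite coroots come from the simple ones
   by induction on the height.  Any root alpha is moved by the finite Weyl group
   to some alpha' with <theta^, alpha'> > 0, that is, alpha' = theta, where
   - theta^ + delta is the affine simple root, or <theta^, alpha'> = 1, where
   - alpha'^ + r delta is the image of a finite coroot under the affine simple
   reflection and r = <alpha'^, theta>. *)
Require Import Defs.
From mathcomp Require Import all_boot all_order all_algebra.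
From mathcomp Require Import reals complex boolp.
From mathcomp Require Import ring lra zify.

Set Implicit Arguments.
Unset Strict Implicit.
Unset Printing Implicit Defensive.

Import Order.TTheory GRing.Theory Num.Theory.
Local Open Scope ring_scope.

(** * Exponentials of locally nilpotent operators *)

Section LinearFunctions.
Variables (K : fieldType) (V W : lmodType K) (f : V -> W).
Hypothesis fl : linear f.

Lemma lin0 : f 0 = 0.
Proof. by have := fl (-1) 0 0; rewrite scaler0 addr0 scaleN1r addNr. Qed.

Lemma linD u v : f (u + v) = f u + f v.
Proof. by have := fl 1 u v; rewrite !scale1r. Qed.

Lemma linZ a u : f (a *: u) = a *: f u.
Proof. by have := fl a u 0; rewrite !addr0 lin0 addr0. Qed.

Lemma linN u : f (- u) = - f u.
Proof. by rewrite -scaleN1r linZ scaleN1r. Qed.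

Lemma linB u v : f (u - v) = f u - f v.
Proof. by rewrite linD linN. Qed.

Lemma lin_sum I (r : seq I) (P : pred I) F :
  f (\sum_(i <- r | P i) F i) = \sum_(i <- r | P i) f (F i).
Proof. by apply: (big_morph f linD lin0). Qed.

End LinearFunctions.

Section LinearForms.
Variables (K : fieldType) (V : lmodType K) (f : V -> K).
Hypothesis fl : linear_for *%R f.

Lemma linfZ a u : f (a *: u) = a * f u.
Proof. exact: (linZ (W := K^o) fl). Qed.

Lemma linfN u : f (- u) = - f u.
Proof. exact: (linN (W := K^o) fl). Qed.

Lemma linfB u v : f (u - v) = f u - f v.
Proof. exact: (linB (W := K^o) fl). Qed.

Lemma linf_sum I (r : seq I) (P : pred I) F :
  f (\sum_(i <- r | P i) F i) = \sum_(i <- r | P i) f (F i).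
Proof. exact: (lin_sum (W := K^o) fl). Qed.

End LinearForms.

Lemma iter_linear (K : fieldType) (V : lmodType K) (D : V -> V) k :
  linear D -> linear (iter k D).
Proof. by move=> Dl a u v; elim: k => //= k ->; rewrite Dl. Qed.

Section DividedPowers.
Variable K : numFieldType.

(** The factorial removes the binomial coefficients from the Leibniz rule. *)
Definition divpow (V : lmodType K) (D : V -> V) k v : V :=
  (k`!%:R)^-1 *: iter k D v.

Lemma divpow_linear (V : lmodType K) (D : V -> V) k :
  linear D -> linear (divpow D k).
Proof.
move=> Dl a u v; rewrite /divpow (iter_linear k Dl) scalerDr !scalerA.
by rewrite mulrC.
Qed.

Lemma divpow_eq0 (V : lmodType K) (D : V -> V) k v :
  (divpow D k v == 0) = (iter k D v == 0).
Proof.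
by rewrite scaler_eq0 invr_eq0 pnatr_eq0 eqn0Ngt fact_gt0.
Qed.

Lemma divpowS (V : lmodType K) (D : V -> V) k v : linear D ->
  D (divpow D k v) = k.+1%:R *: divpow D k.+1 v.
Proof.
move=> Dl; rewrite /divpow (linZ Dl) scalerA factS natrM invfM.
by rewrite mulrA divff ?pnatr_eq0 // mul1r.
Qed.

Lemma iter_eq0_leq (V : lmodType K) (D : V -> V) N M v : linear D ->
  (N <= M)%N -> iter N D v = 0 -> iter M D v = 0.
Proof.
move=> Dl /subnK <- v0; rewrite iterD v0.
by apply: lin0; exact: iter_linear.
Qed.

(** * Leibniz rule for divided powers along a bilinear map *)

Section Leibniz.
Variables (U V W : lmodType K) (mu : U -> V -> W).
Variables (DU : U -> U) (DV : V -> V) (DW : W -> W).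
Hypotheses (mul : forall v, linear (mu^~ v)) (mur : forall u, linear (mu u)).
Hypotheses (DUl : linear DU) (DVl : linear DV) (DWl : linear DW).
Hypothesis Dmu : forall u v, DW (mu u v) = mu (DU u) v + mu u (DV v).

(** Induction on $n$: applying [DW] produces $(i+1)F(i+1)$ and $(n+1-i)F(i)$, so each $F(i)$ is
    collected with total coefficient $n+1$. *)
Lemma divpow_leibniz n u v : divpow DW n (mu u v) =
  \sum_(i < n.+1) mu (divpow DU i u) (divpow DV (n - i) v).
Proof.
elim: n => [|n IH].
  by rewrite big_ord1 /divpow /= fact0 invr1 !scale1r.
have n0 : n.+1%:R != 0 :> K by rewrite pnatr_eq0.
apply: (scalerI n0); rewrite -divpowS // IH (lin_sum DWl).
under eq_bigr do rewrite Dmu !divpowS //.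
rewrite big_split /=.
rewrite scaler_sumr.
pose F i := mu (divpow DU i u) (divpow DV (n.+1 - i) v).
transitivity (\sum_(i < n.+1) i.+1%:R *: F i.+1 +
              \sum_(i < n.+1) (n.+1 - i)%:R *: F i).
  congr (_ + _); apply: eq_bigr => i _; rewrite /F.
    by rewrite (linZ (mul _)).
  by rewrite (linZ (mur _)) subSn // -ltnS.
have -> : \sum_(i < n.+1) i.+1%:R *: F i.+1 = \sum_(i < n.+2) i%:R *: F i.
  by rewrite [RHS]big_ord_recl scale0r add0r; apply: eq_bigr.
have -> : \sum_(i < n.+1) (n.+1 - i)%:R *: F i =
          \sum_(i < n.+2) (n.+1 - i)%:R *: F i.
  by rewrite [RHS]big_ord_recr /= subnn scale0r addr0.
rewrite -big_split; apply: eq_bigr => i _ /=.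
by rewrite -scalerDl -natrD subnKC // -ltnS.
Qed.

(** In each Leibniz term either $i\ge N$ kills the first factor, or $N+M-i>M$ kills the second. *)
Lemma leibniz_eq0 N M u v : iter N DU u = 0 -> iter M DV v = 0 ->
  iter (N + M) DW (mu u v) = 0.
Proof.
move=> u0 v0; apply/eqP; rewrite -divpow_eq0 divpow_leibniz; apply/eqP.
apply: big1 => i _; case: (leqP N i) => [Ni|iN].
  have /eqP -> : divpow DU i u == 0.
    by rewrite divpow_eq0 (iter_eq0_leq DUl Ni u0).
  exact: lin0 (mul _).
have /eqP -> : divpow DV (N + M - i) v == 0.
  by rewrite divpow_eq0 (iter_eq0_leq DVl _ v0) //; lia.
exact: lin0 (mur _).
Qed.

End Leibniz.

(** * Bijectivity of the exponential of a locally nilpotent operator *)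

Section Exponential.
Variables (V : lmodType K) (D : V -> V).
Hypotheses (Dl : linear D) (Dnil : forall v, exists N, iter N D v = 0).

Let Dnilb v : exists N, iter N D v == 0.
Proof. by have [N /eqP] := Dnil v; exists N. Qed.

(** The exponential series, cut at the least power of [D] that kills [v]; [lexpE] shows that any
    other vanishing power gives the same value. *)
Definition lexp v : V := \sum_(i < ex_minn (Dnilb v)) divpow D i v.

Lemma lexpE N v : iter N D v = 0 -> lexp v = \sum_(i < N) divpow D i v.
Proof.
rewrite /lexp; case: ex_minnP => m /eqP m0 mmin /eqP/mmin mN.
rewrite -!(big_mkord xpredT (divpow D ^~ v)) (big_cat_nat (leq0n m) mN) /=.
rewrite [X in _ + X]big1_seq ?addr0 // => i.
rewrite mem_index_iota => /and3P[_ mi _].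
by apply/eqP; rewrite divpow_eq0 (iter_eq0_leq Dl mi m0).
Qed.

Lemma lexp_linear : linear lexp.
Proof.
move=> a u v; have [N uN] := Dnil u; have [M vM] := Dnil v.
have u0 := iter_eq0_leq Dl (leq_addr M N) uN.
have v0 := iter_eq0_leq Dl (leq_addl N M) vM.
rewrite (lexpE u0) (lexpE v0) (@lexpE (N + M)).
  rewrite scaler_sumr -big_split; apply: eq_bigr => i _.
  by rewrite divpow_linear.
by rewrite (iter_linear _ Dl) u0 v0 scaler0 addr0.
Qed.

(** The operator $1-\exp D$ is divisible by $D$, so it lowers the order of nilpotency of a vector by
    one. Injectivity and surjectivity of $\exp D$ both follow by induction on that order. *)
Lemma iter_lexp_eq0 N v : iter N.+1 D v = 0 -> iter N D (v - lexp v) = 0.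
Proof.
move=> v0; rewrite (lexpE v0) big_ord_recl {1}/divpow fact0 invr1 scale1r /=.
rewrite opprD addrA subrr add0r (linN (iter_linear N Dl)).
rewrite (lin_sum (iter_linear N Dl)) big1 ?oppr0 // => i _.
rewrite /divpow (linZ (iter_linear N Dl)) -iterD.
by rewrite (@iter_eq0_leq _ _ N.+1 _ _ Dl) ?scaler0 //= /bump /=; lia.
Qed.

Lemma lexp_inj : injective lexp.
Proof.
move=> u v euv; apply/eqP; rewrite -subr_eq0; apply/eqP.
have : lexp (u - v) = 0 by rewrite (linB lexp_linear) euv subrr.
move: (u - v) => {u v euv} w; have [N] := Dnil w.
elim: N => // N IH wN w0; apply: IH => //.
by rewrite -(iter_lexp_eq0 wN) w0 subr0.
Qed.

Lemma lexp_surj v : exists u, lexp u = v.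
Proof.
have [N] := Dnil v; elim: N v => [v /= ->|N IH v vN].
  by exists 0; rewrite (lin0 lexp_linear).
(* With $u$ a preimage of $v-\exp(D)v$, the vector $v+u$ is a preimage of $v$. *)
have [u uE] := IH _ (iter_lexp_eq0 vN); exists (v + u).
by rewrite (linD lexp_linear) uE addrC subrK.
Qed.

End Exponential.

(** Cauchy product: the rectangle lies in the triangle $i+j<N+M$, and the remaining terms of the
    triangle vanish. *)
Lemma sum_triangle (W : nmodType) N M (F : nat -> nat -> W) :
  (forall i j, (N <= i)%N || (M <= j)%N -> F i j = 0) ->
  \sum_(n < N + M) \sum_(i < n.+1) F i (n - i)%N =
  \sum_(i < N) \sum_(j < M) F i j.
Proof.
move=> F0.
have inner (n : 'I_(N + M)) : \sum_(i < n.+1) F i (n - i)%N =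
    \sum_(i < N) \sum_(j < M | (i + j)%N == n) F i j.
  transitivity (\sum_(i < N + M | (i < n.+1)%N) F i (n - i)%N).
    by rewrite (big_ord_widen_cond (N + M) xpredT (fun i => F i (n - i)%N)).
  rewrite big_split_ord /= [X in _ + X]big1 ?addr0; last first.
    by move=> i _; rewrite F0 // leq_addr.
  rewrite big_mkcond; apply: eq_bigr => i _ /=; case: ifP => in_.
    case: (ltnP (n - i) M) => [nM|Mn].
      rewrite (big_pred1 (Ordinal nM)) // => j /=.
      by rewrite -val_eqE /=; lia.
    by rewrite F0 ?Mn ?orbT // big_pred0 // => j; have := ltn_ord j; lia.
  by rewrite big_pred0 // => j; lia.
under eq_bigr do rewrite inner.
rewrite exchange_big; apply: eq_bigr => i _ /=.
under eq_bigr do rewrite big_mkcond.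
rewrite exchange_big; apply: eq_bigr => j _ /=.
have ijl : (i + j < N + M)%N by have := ltn_ord i; have := ltn_ord j; lia.
by rewrite -big_mkcond (big_pred1 (Ordinal ijl)).
Qed.

(** The Leibniz rule turns the left side into a Cauchy product, which [sum_triangle] factors. It is
    used for the bracket and for the action on the module. *)
Lemma lexp_mul (U V W : lmodType K) (mu : U -> V -> W) DU DV DW
    (nU : forall u, exists N, iter N DU u = 0)
    (nV : forall v, exists N, iter N DV v = 0)
    (nW : forall w, exists N, iter N DW w = 0) :
  (forall v, linear (mu^~ v)) -> (forall u, linear (mu u)) ->
  linear DU -> linear DV -> linear DW ->
  (forall u v, DW (mu u v) = mu (DU u) v + mu u (DV v)) ->
  forall u v, lexp nW (mu u v) = mu (lexp nU u) (lexp nV v).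
Proof.
move=> mul mur DUl DVl DWl Dmu u v.
have [N uN] := nU u; have [M vM] := nV v.
rewrite (lexpE DUl nU uN) (lexpE DVl nV vM).
rewrite (lexpE DWl nW (leibniz_eq0 mul mur DUl DVl DWl Dmu uN vM)).
under eq_bigr do rewrite (divpow_leibniz mul mur DUl DVl DWl Dmu).
rewrite (@sum_triangle _ N M (fun i j => mu (divpow DU i u) (divpow DV j v))).
  rewrite (lin_sum (mul _)); apply: eq_bigr => i _.
  by rewrite (lin_sum (mur _)).
move=> i j /orP[Ni|Mj].
  have /eqP -> : divpow DU i u == 0.
    by rewrite divpow_eq0 (iter_eq0_leq DUl Ni uN).
  exact: lin0 (mul _).
have /eqP -> : divpow DV j v == 0.
  by rewrite divpow_eq0 (iter_eq0_leq DVl Mj vM).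
exact: lin0 (mur _).
Qed.

End DividedPowers.

(** * Lie modules and sl2 *)

Section LieBasics.
Variables (K : fieldType) (L : lieAlgebra K).

Lemma lie_anti (x y : L) : lie_br x y = - lie_br y x.
Proof.
have := lie_alt (x + y).
rewrite (linD (lie_linearl _)) !(linD (lie_linearr _)) !lie_alt add0r addr0.
by move/eqP; rewrite addr_eq0 => /eqP.
Qed.

Lemma lie_der (x y z : L) :
  lie_br x (lie_br y z) = lie_br (lie_br x y) z + lie_br y (lie_br x z).
Proof.
have /eqP := lie_jacobi x y z; rewrite -addrA addr_eq0 => /eqP ->.
rewrite opprD addrC [lie_br z _]lie_anti opprK [lie_br z x]lie_anti.
by rewrite (linN (lie_linearr _)) opprK.
Qed.

Lemma ad_lact_br (x y z : L) :
  lie_br (lie_br x y) z = lie_br x (lie_br y z) - lie_br y (lie_br x z).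
Proof. by rewrite (lie_der x) addrK. Qed.

(** Viewing the bracket as an action lets the sl2 formulas and the nilpotency notions for modules
    apply to the algebra itself. *)
Definition adjoint : lieModule L :=
  LieModule (@lie_linearl K L) (@lie_linearr K L) ad_lact_br.

Lemma lact_der (V : lieModule L) (x y : L) (v : V) :
  lact x (lact y v) = lact (lie_br x y) v + lact y (lact x v).
Proof. by rewrite lact_br subrK. Qed.

Definition lact_lin (V : lieModule L) (x : L) : linear (@lact _ L V x) :=
  lact_linearr x.
Definition lactl_lin (V : lieModule L) (v : V) :
  linear ((@lact _ L V)^~ v) := lact_linearl v.

End LieBasics.
Arguments lact_lin {K L V} x.
Arguments lactl_lin {K L V} v.

Section Sl2.
Variables (K : numFieldType) (L : lieAlgebra K) (V : lieModule L).
Variables e f h : L.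
Hypotheses (efh : lie_br e f = h) (hee : lie_br h e = 2 *: e).
Hypothesis (hff : lie_br h f = - 2 *: f).

Lemma sl2_weight (v : V) c k : lact h v = c *: v ->
  lact h (iter k (lact e) v) = (c + (2 * k)%:R) *: iter k (lact e) v.
Proof.
move=> hv; elim: k => [|k IH] /=; first by rewrite muln0 addr0.
rewrite lact_der hee (linZ (lactl_lin _)) IH (linZ (lact_lin _)) -scalerDl.
by congr (_ *: _); rewrite mulnS natrD; ring.
Qed.

Lemma sl2_fweight (v : V) c k : lact h v = c *: v ->
  lact h (iter k (lact f) v) = (c - (2 * k)%:R) *: iter k (lact f) v.
Proof.
move=> hv; elim: k => [|k IH] /=; first by rewrite muln0 subr0.
rewrite lact_der hff (linZ (lactl_lin _)) IH (linZ (lact_lin _)) -scalerDl.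
by congr (_ *: _); rewrite mulnS natrD; ring.
Qed.

(** The commutator formula $[f,e^{k+1}]=-(k+1)e^k(h+k)$, evaluated on a vector of weight $c$. *)
Lemma sl2_fe (v : V) c k : lact h v = c *: v ->
  lact f (iter k.+1 (lact e) v) =
  iter k.+1 (lact e) (lact f v) - (k.+1%:R * (c + k%:R)) *: iter k (lact e) v.
Proof.
have fe u : lact f (lact e u) = lact e (lact f u) - lact h u.
  by rewrite lact_der lie_anti efh (linN (lactl_lin _)) addrC.
move=> hv; elim: k => [|k IH]; first by rewrite /= fe hv mul1r addr0.
rewrite iterS fe IH (linB (lact_lin _)) (linZ (lact_lin _)) (sl2_weight _ hv).
rewrite -!iterS -addrA -opprD -scalerDl; congr (_ - _ *: _).
by rewrite natrM -!natr1; ring.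
Qed.

(** By [sl2_fe], $fe^{a+1}v=(a+1)(m-a)e^av$ with a nonzero coefficient for $a<m$, so vanishing
    descends from $e^{a+1}v$ to $e^av$. *)
Lemma sl2_lowest (v : V) m a : lact h v = - m%:R *: v -> lact f v = 0 ->
  (a <= m)%N -> iter a (lact e) v = 0 -> v = 0.
Proof.
move=> hv fv; elim: a => // a IH am ev; apply: IH (ltnW am) _.
have := sl2_fe a hv; rewrite ev fv (lin0 (lact_lin _)).
rewrite (lin0 (iter_linear _ (lact_lin _))) sub0r => /eqP.
rewrite eq_sym oppr_eq0 scaler_eq0 mulf_eq0 pnatr_eq0 /= addrC subr_eq0 eqr_nat.
by rewrite ltn_eqF // => /eqP.
Qed.

(* [e^(a+1) f v] is a combination of [f e^(a+1) v] and [e^a v], so applying  *)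
(* [f] repeatedly reduces the claim to a lowest weight vector.               *)
Lemma sl2_inj (v : V) m : lact h v = - m%:R *: v ->
  (exists N, iter N (lact f) v = 0) -> iter m (lact e) v = 0 -> v = 0.
Proof.
move=> hv [N fv] ev.
have ef N' : iter (m + N') (lact e) (iter N' (lact f) v) = 0.
  elim: N' => [|k IH]; first by rewrite addn0.
  have := sl2_fe (m + k) (sl2_fweight k hv).
  rewrite iterS IH !(lin0 (lact_lin _)) scaler0 subr0 => /esym.
  by rewrite addnS.
(* If $f^{k+1}v=0$, then $f^kv$ is a lowest weight vector of weight $-(m+2k)$ killed by $e^{m+k}$;
   as $m+k\le m+2k$, it is zero. *)
elim: N fv => // k IH fv; apply: IH.
apply: (@sl2_lowest _ (m + 2 * k) (m + k) _ fv _ (ef k)); last by lia.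
by rewrite (sl2_fweight k hv) natrD opprD.
Qed.

Lemma sl2_iter_neq0 (v : V) m k : lact h v = - m%:R *: v -> v != 0 ->
  (exists N, iter N (lact f) v = 0) -> (k <= m)%N -> iter k (lact e) v != 0.
Proof.
move=> hv v0 fv km; apply: contraNneq v0 => ev.
apply/eqP/(sl2_inj hv fv)/(iter_eq0_leq (lact_lin _) km ev).
Qed.

End Sl2.

(** * Structure of Kac-Moody algebras *)

Section OppositeKacMoody.
Variables (K : fieldType) (m : nat) (A : 'M[int]_m) (h : realization K A).

Let sroot_opp_linear j : linear_for *%R (fun x => - sroot (r := h) j x).
Proof. by move=> a u v; rewrite sroot_linear opprD mulrN. Qed.

Let scoroot_opp_free (c : 'I_m -> K) :
  \sum_i c i *: - scoroot h i = 0 -> forall i, c i = 0.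
Proof.
move=> c0; apply: (scoroot_free (r := h)).
apply: oppr_inj; rewrite oppr0 -[RHS]c0 -sumrN.
by apply: eq_bigr => i _; rewrite scalerN.
Qed.

Let sroot_opp_free (c : 'I_m -> K) :
  (forall x, \sum_j c j * - sroot (r := h) j x = 0) -> forall j, c j = 0.
Proof.
move=> c0; apply: (sroot_free (r := h)) => x.
apply: oppr_inj; rewrite oppr0 -[RHS](c0 x) -sumrN.
by apply: eq_bigr => i _; rewrite mulrN.
Qed.

Let sroot_scoroot_opp i j :
  - sroot (r := h) j (- scoroot h i) = (A i j)%:~R.
Proof. by rewrite (linfN (sroot_linear _)) opprK sroot_scoroot. Qed.

Definition opp_realization : realization K A :=
  Realization sroot_opp_linear scoroot_opp_free sroot_opp_free
    sroot_scoroot_opp (cartan_dim h).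

Variable g : kacMoody h.

Let km_ef_opp i j : lie_br (km_f g i) (km_e g j) =
  if i == j then km_h g (- scoroot h i) else 0.
Proof.
rewrite lie_anti km_ef eq_sym; case: eqP => [->|_]; last exact: oppr0.
by rewrite (linN (km_h_linear g)).
Qed.

Let km_hf_opp x i : lie_br (km_h g x) (km_e g i) =
  - (- sroot (r := h) i x) *: km_e g i.
Proof. by rewrite opprK km_he. Qed.

Let km_generated_opp (S : g -> Prop) : is_subalgebra S ->
  (forall x, S (km_h g x)) -> (forall i, S (km_f g i)) ->
  (forall i, S (km_e g i)) -> forall y, S y.
Proof. by move=> Ss Sh Sf Se; apply: km_generated. Qed.

(* Exchanging the e_i and the f_i on the same Lie algebra turns each         *)
(* statement on the e_i into one on the f_i.                                 *)
Definition opp_kacMoody : kacMoody opp_realization :=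
  @KacMoody _ _ _ opp_realization g (km_h g) (km_f g) (km_e g)
    (km_h_linear g) (@km_h_inj _ _ _ _ g) (km_hh g)
    (km_hf g) km_hf_opp km_ef_opp km_generated_opp
    (@km_no_ideal _ _ _ _ g).

End OppositeKacMoody.

Section KacMoodyStructure.
Variables (K : numFieldType) (m : nat) (A : 'M[int]_m) (h : realization K A).
Variable g : kacMoody h.

Local Notation br := (@lie_br K g).
Local Notation H := (km_h g).
Local Notation e := (km_e g).
Local Notation f := (km_f g).

(** The simple roots are independent functionals, so the matrix of their values on a basis of the
    Cartan subalgebra has a left inverse; its rows give the dual elements. *)
Lemma fund_dual : exists om : 'I_m -> cartan h,
  forall i j, sroot j (om i) = (i == j)%:R.
Proof.
pose b := vbasis {: cartan h}.
pose M : 'M[K]_(\dim {: cartan h}, m) := \matrix_(k, j) sroot j b`_k.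
have Mf : row_full M.
  rewrite /row_full -mxrank_tr -/(row_free _) -kermx_eq0.
  apply/rowV0P => u /sub_kermxP uM; apply/rowP => j; rewrite [RHS]mxE.
  apply: (sroot_free (r := h) (c := u 0)) => x.
  rewrite (coord_vbasis (memvf x)).
  under eq_bigr do rewrite (linf_sum (sroot_linear _)) mulr_sumr.
  rewrite exchange_big big1 // => k _ /=.
  under eq_bigr do rewrite (linfZ (sroot_linear _)) mulrCA.
  rewrite -mulr_sumr; have := congr1 (fun N : 'rV_(_) => N 0 k) uM.
  rewrite !mxE => uMk; rewrite [X in _ * X](_ : _ = 0) ?mulr0 // -[RHS]uMk.
  by apply: eq_bigr => j' _; rewrite !mxE.
have [P PM] := row_fullP Mf.
exists (fun i => \sum_k P i k *: b`_k) => i j.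
rewrite (linf_sum (sroot_linear _)).
under eq_bigr do rewrite (linfZ (sroot_linear _)).
have := congr1 (fun N : 'M_(_) => N i j) PM; rewrite !mxE => <-.
by apply: eq_bigr => k _; rewrite !mxE.
Qed.

(** The sum of the fundamental coweights; its adjoint action measures height. *)
Lemma height_coweight : exists rho : cartan h, forall j, sroot j rho = 1.
Proof.
have [om omE] := fund_dual; exists (\sum_k om k) => j.
rewrite (linf_sum (sroot_linear _)) (bigD1 j) //= omE eqxx big1 ?addr0 //.
by move=> k kj; rewrite omE (negPf kj).
Qed.

(** The elements whose bracket preserves [S] form a subalgebra, so testing generators suffices. *)
Lemma gen_stable (S : g -> Prop) : is_subspace S ->
  (forall t x, S x -> S (br (H t) x)) -> (forall i x, S x -> S (br (e i) x)) ->
  (forall i x, S x -> S (br (f i) x)) -> forall y x, S x -> S (br y x).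
Proof.
move=> [S0 SL] Sh Se Sf; apply: km_generated => //; split.
  split=> [x Sx|a u v Su Sv x Sx].
    by rewrite (lin0 (lie_linearl _)).
  by rewrite (lie_linearl x); apply: SL; [exact: Su|exact: Sv].
move=> u v Su Sv x Sx; rewrite ad_lact_br -scaleN1r addrC.
by apply: SL; [apply: Sv; exact: Su|apply: Su; exact: Sv].
Qed.

(** * Heights as eigenvalues of an adjoint operator *)

Section Height.
Variable rho : cartan h.

(** The operator $\mathrm{ad}(\rho)-c$. Products of these commuting operators that kill an element
    bound its heights without a root space decomposition. *)
Definition shift_ad c (y : g) : g := br (H rho) y - c *: y.

Lemma shift_ad_linear c : linear (shift_ad c).
Proof.
move=> a u v; rewrite /shift_ad (lie_linearr _) scalerDr scalerBr opprD addrACA.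
by rewrite !scalerA mulrC.
Qed.

Lemma shift_adC c d y : shift_ad c (shift_ad d y) = shift_ad d (shift_ad c y).
Proof.
rewrite /shift_ad !(linB (lie_linearr _)) !(linZ (lie_linearr _)) !scalerBr.
rewrite !opprB !scalerA [d * c]mulrC !addrA [LHS]addrAC [RHS]addrAC.
by congr (_ + _); rewrite -!addrA; congr (_ + _); rewrite addrC.
Qed.

Definition shift_ads (s : seq K) (y : g) : g := foldr shift_ad y s.

Lemma shift_ads_linear s : linear (shift_ads s).
Proof. by move=> a u v; elim: s => //= c s ->; rewrite shift_ad_linear. Qed.

Lemma shift_adsC c s y :
  shift_ads s (shift_ad c y) = shift_ad c (shift_ads s y).
Proof. by elim: s => //= d s ->; rewrite shift_adC. Qed.

Lemma shift_ads_cat0 s s' y : shift_ads s y = 0 -> shift_ads (s' ++ s) y = 0.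
Proof.
by rewrite /shift_ads foldr_cat => ->; exact: lin0 (shift_ads_linear _).
Qed.

Lemma shift_ads_catC s s' y : shift_ads (s ++ s') y = shift_ads (s' ++ s) y.
Proof.
rewrite /shift_ads !foldr_cat -!/(shift_ads _ _).
elim: s => //= c s IH; rewrite shift_adsC; congr (shift_ad c _); exact: IH.
Qed.

(* [ad rho] has its eigenvalues in [I] on the cyclic subspace of [y].        *)
Definition spec_in (I : K -> Prop) (y : g) : Prop :=
  exists2 s, forall c, c \in s -> I c & shift_ads s y = 0.

Lemma spec_in_subspace I : is_subspace (spec_in I).
Proof.
split=> [|a u v [s sI su] [r rI rv]]; first by exists [::].
exists (s ++ r) => [c|]; first by rewrite mem_cat => /orP[/sI //|/rI].
rewrite (shift_ads_linear _) (shift_ads_cat0 _ rv) shift_ads_catC.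
by rewrite (shift_ads_cat0 _ su) scaler0 addr0.
Qed.

Lemma spec_inD I u v : spec_in I u -> spec_in I v -> spec_in I (u + v).
Proof.
have [_ L] := spec_in_subspace I.
by move=> Iu /(L 1 _ _ Iu); rewrite scale1r.
Qed.

Lemma spec_in_mono (I J : K -> Prop) y : (forall c, I c -> J c) ->
  spec_in I y -> spec_in J y.
Proof. by move=> IJ [s sI sy]; exists s => // c /sI/IJ. Qed.

Lemma spec_in_eigen (I : K -> Prop) c y :
  br (H rho) y = c *: y -> I c -> spec_in I y.
Proof.
move=> yc Ic; exists [:: c] => [d|]; first by rewrite inE => /eqP ->.
by rewrite /= /shift_ad yc subrr.
Qed.

(** On an eigenvector the product of the shifted operators is the scalar $\prod_d(c-d)$, nonzero
    when $c$ is none of the $d$. *)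
Lemma eigen_spec_out (I : K -> Prop) c y :
  br (H rho) y = c *: y -> ~ I c -> spec_in I y -> y = 0.
Proof.
move=> yc Ic [s sI sy].
have sE : shift_ads s y = (\prod_(d <- s) (c - d)) *: y.
  elim: s {sI sy} => [|d s IH] /=; first by rewrite big_nil scale1r.
  rewrite IH (linZ (shift_ad_linear d)) /shift_ad yc -scalerBl scalerA.
  by rewrite big_cons mulrC.
move/eqP: sy; rewrite sE scaler_eq0 => /orP[|/eqP//].
rewrite prodf_seq_eq0 => /hasP[d ds /=].
by rewrite subr_eq0 => /eqP cd; case: Ic; rewrite cd; exact: sI.
Qed.

Definition natge n (c : K) : Prop := exists2 k, (n <= k)%N & c = k%:R.

(** Since $(\mathrm{ad}\rho-c-d)[x,y]=[x,(\mathrm{ad}\rho-c)y]$, bracketing with $x$ translates the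
    eigenvalues by $d$. *)
Lemma spec_in_shift I J d x y : br (H rho) x = d *: x ->
  (forall c, I c -> J (c + d)) -> spec_in I y -> spec_in J (br x y).
Proof.
move=> xd IJ [s sI sy]; exists [seq c + d | c <- s] => [c /mapP[b /sI/IJ]|].
  by move=> ? ->.
suff -> : shift_ads [seq c + d | c <- s] (br x y) = br x (shift_ads s y).
  by rewrite sy (lin0 (lie_linearr _)).
elim: s {sI sy} => //= c s ->; rewrite /shift_ad lie_der xd.
rewrite (linZ (lie_linearl _)) (linB (lie_linearr _)) (linZ (lie_linearr _)).
rewrite scalerDl opprD addrA.
by rewrite -!addrA addrC -addrA; congr (_ + _); rewrite -addrA addNr addr0.
Qed.

End Height.

(** Used twice: generated by a vector killed by all [f i] it is the ideal of [lowest_eq0], and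
    generated by the [e i] it is the positive part $\mathfrak n_+$. *)
Inductive eclos (X : g -> Prop) : g -> Prop :=
| eclos0 : eclos X 0
| eclosX x : X x -> eclos X x
| eclosE i x : eclos X x -> eclos X (br (e i) x)
| eclosL a x y : eclos X x -> eclos X y -> eclos X (a *: x + y).

Lemma eclos_subspace X : is_subspace (eclos X).
Proof. by split; [exact: eclos0|move=> a u v; exact: eclosL]. Qed.

Lemma eclosZ X a x : eclos X x -> eclos X (a *: x).
Proof. by move=> Xx; rewrite -[_ *: _]addr0; apply: eclosL Xx (eclos0 X). Qed.

Lemma eclosD X x y : eclos X x -> eclos X y -> eclos X (x + y).
Proof. by move=> Xx Xy; rewrite -[x]scale1r; exact: eclosL. Qed.

Lemma eclosN X x : eclos X x -> eclos X (- x).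
Proof. by rewrite -scaleN1r; exact: eclosZ. Qed.

Lemma eclos_h X : (forall x, X x -> exists mu : cartan h -> K,
    forall t, br (H t) x = mu t *: x) ->
  forall t x, eclos X x -> eclos X (br (H t) x).
Proof.
move=> Xh t x; elim=> {x} [|x Xx|i x Xx IH|a x y _ IHx _ IHy].
- by rewrite (lin0 (lie_linearr _)); exact: eclos0.
- by have [mu ->] := Xh _ Xx; apply: eclosZ; exact: eclosX.
- rewrite lie_der km_he (linZ (lie_linearl _)); apply: eclosL; exact: eclosE.
- by rewrite (lie_linearr _); exact: eclosL.
Qed.

(** Moving $\mathrm{ad}f_j$ past $\mathrm{ad}e_i$ leaves only a Cartan element, which preserves the
    closure by [eclos_h]. *)
Lemma eclos_f X : (forall x, X x -> exists mu : cartan h -> K,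
    forall t, br (H t) x = mu t *: x) ->
  (forall i x, X x -> br (f i) x = 0) ->
  forall i x, eclos X x -> eclos X (br (f i) x).
Proof.
move=> Xh Xf j x; elim=> {x} [|x Xx|i x Xx IH|a x y _ IHx _ IHy].
- by rewrite (lin0 (lie_linearr _)); exact: eclos0.
- by rewrite Xf //; exact: eclos0.
- rewrite lie_der; apply: eclosD; last exact: eclosE.
  rewrite [br (f j) (e i)]lie_anti km_ef (linN (lie_linearl _)); apply: eclosN.
  case: eqP => _; first exact: eclos_h.
  by rewrite (lin0 (lie_linearl _)); exact: eclos0.
- by rewrite (lie_linearr _); exact: eclosL.
Qed.

Lemma eclos_spec rho X I : (forall j, sroot j rho = 1) ->
  (forall c, I c -> I (c + 1)) -> (forall x, X x -> spec_in rho I x) ->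
  forall x, eclos X x -> spec_in rho I x.
Proof.
move=> rho1 I1 XI x; have [I0 IL] := spec_in_subspace rho I.
elim=> {x} [|x /XI|i x _|a x y _ Ix _ Iy] //.
  by apply: spec_in_shift I1; rewrite km_he rho1.
exact: IL.
Qed.

(* The span of the translates of [x] under the [ad e_i] is an ideal of       *)
(* elements of positive height, which thus meets [h] trivially.              *)
Lemma lowest_eq0 rho (x : g) (mu : cartan h -> K) k :
  (forall j, sroot j rho = 1) -> (forall t, br (H t) x = mu t *: x) ->
  mu rho = k.+1%:R -> (forall i, br (f i) x = 0) -> x = 0.
Proof.
move=> rho1 xmu muk xf.
have Xh y : eq x y ->
    exists nu : cartan h -> K, forall t, br (H t) y = nu t *: y.
  by move=> <-; exists mu.
have Xf i y : eq x y -> br (f i) y = 0 by move=> <-.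
apply: (km_no_ideal (k := g) (S := eclos (eq x))); last exact: eclosX.
- split; first exact: eclos_subspace.
  apply: gen_stable; [exact: eclos_subspace|exact: eclos_h|exact: eclosE|].
  exact: eclos_f.
- move=> t Xt; apply: (@eigen_spec_out rho (natge 1) 0).
  + by rewrite km_hh scale0r.
  + by case=> j j1 /eqP; rewrite eq_sym pnatr_eq0; case: j j1.
  apply: (eclos_spec rho1 _ _ Xt) => [c [j j1 ->]|y <-].
    by exists j.+1; rewrite ?natr1 //; lia.
  by apply: (spec_in_eigen (xmu rho)); exists k.+1.
Qed.

(** * Serre relations and local nilpotency of the simple root vectors *)

Hypothesis Aii : forall i, A i i = 2.
Hypothesis Aij : forall i j, i != j -> A i j <= 0.
Hypothesis A0 : forall i j, A i j = 0 -> A j i = 0.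

Lemma lie_iter_weight t (x y : g) a b n : br (H t) x = a *: x ->
  br (H t) y = b *: y ->
  br (H t) (iter n (lie_br x) y) = (b + a *+ n) *: iter n (lie_br x) y.
Proof.
move=> xa yb; elim: n => [|n IH]; first by rewrite mulr0n addr0.
rewrite iterS lie_der xa IH (linZ (lie_linearl _)) (linZ (lie_linearr _)).
by rewrite -scalerDl mulrS addrCA.
Qed.

(** The element is a weight vector of positive height killed by every $f_k$, so [lowest_eq0]
    applies. *)
Lemma serre i j : i != j ->
  iter `|1 - A i j| (lie_br (e i)) (e j) = 0.
Proof.
move=> ij; have [rho rho1] := height_coweight.
have [p pE] : exists p : nat, A i j = - p%:Z.
  by exists `|A i j|%N; have := Aij ij; lia.
have -> : `|1 - A i j|%N = p.+1 by lia.
apply: (lowest_eq0 (mu := fun t => sroot j t + sroot i t *+ p.+1)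
  (k := p.+1) rho1).
- by move=> t; apply: lie_iter_weight; exact: km_he.
- by rewrite !rho1 [RHS]mulrS.
(* For $k=i$, the vector $e_j$ has weight $-p$, and the coefficient $(p+1)(-p+p)$ in [sl2_fe]
   vanishes. *)
move=> k; have [->|ki] := eqVneq k i.
  have hh : br (H (scoroot h i)) (e j) = - p%:R *: e j.
    by rewrite km_he sroot_scoroot pE mulrNz.
  have he : br (H (scoroot h i)) (e i) = 2 *: e i.
    by rewrite km_he sroot_scoroot Aii.
  have ef : br (e i) (f i) = H (scoroot h i) by rewrite km_ef eqxx.
  apply: etrans (@sl2_fe K g (adjoint g) _ _ _ ef he (e j) _ p hh) _ => /=.
  rewrite [lie_br (f i) (e j)]lie_anti km_ef eq_sym (negPf ij) oppr0.
  rewrite (lin0 (iter_linear p (lie_linearr _))) (lin0 (lie_linearr _)).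
  by rewrite addNr mulr0 scale0r subr0.
have fk n : br (f k) (iter n (lie_br (e i)) (e j)) =
    iter n (lie_br (e i)) (br (f k) (e j)).
  elim: n => //= n IH; rewrite lie_der IH [br (f k) (e i)]lie_anti km_ef.
  by rewrite eq_sym (negPf ki) oppr0 (lin0 (lie_linearl _)) add0r.
(* For $k=j$ the inner bracket lies in the Cartan subalgebra, and one $\mathrm{ad}e_i$ makes it a
   multiple of $e_i$. If $p>0$ the next $\mathrm{ad}e_i$ kills it; if $p=0$ the multiple is zero
   because $a_{ij}=0$ forces $a_{ji}=0$. *)
rewrite fk lie_anti km_ef; case: eqP => [jk|_]; last first.
  by rewrite oppr0 (lin0 (iter_linear _ (lie_linearr _))).
rewrite (linN (iter_linear _ (lie_linearr _))) iterSr lie_anti km_he.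
rewrite sroot_scoroot -scaleNr (linZ (iter_linear _ (lie_linearr _))).
case: p pE => [|p] pE.
  by rewrite (A0 (i := i)) ?pE // mulr0z oppr0 scale0r oppr0.
by rewrite iterSr lie_alt (lin0 (iter_linear _ (lie_linearr _))) scaler0 oppr0.
Qed.

(** By the Leibniz rule the elements killed by some power of $\mathrm{ad}e_i$ form a subalgebra.
    Among the generators only the $e_j$ with $j\ne i$ need the Serre relations. *)
Lemma ad_e_nilpotent i y : exists N, iter N (lie_br (e i)) y = 0.
Proof.
move: y; apply: km_generated.
- split; first split; first by exists 0%N.
    move=> a u v [N uN] [M vM]; exists (N + M)%N.
    rewrite (iter_linear _ (lie_linearr _)).
    rewrite (iter_eq0_leq (lie_linearr _) (leq_addr M N) uN).
    by rewrite (iter_eq0_leq (lie_linearr _) (leq_addl N M) vM) scaler0 addr0.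
  move=> u v [N uN] [M vM]; exists (N + M)%N.
  apply: (leibniz_eq0 (@lie_linearl K g) (@lie_linearr K g) _ _ _ _ uN vM);
    try exact: lie_linearr.
  exact: lie_der.
- move=> t; exists 2%N; rewrite /= [br (e i) (H _)]lie_anti km_he.
  by rewrite -scaleNr (linZ (lie_linearr _)) lie_alt scaler0.
- move=> j; have [<-|ij] := eqVneq i j; first by exists 1%N; rewrite /= lie_alt.
  by eexists; exact: serre ij.
- move=> j; have [<-|ij] := eqVneq i j; last first.
    by exists 1%N; rewrite /= km_ef (negPf ij).
  exists 3%N; rewrite /= km_ef eqxx [br (e i) (H _)]lie_anti km_he.
  by rewrite -scaleNr (linZ (lie_linearr _)) lie_alt scaler0.
Qed.

End KacMoodyStructure.

Arguments spec_in {K m A h} g rho I y.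
Arguments eclos {K m A h} g X _.

(** * The positive part and its heights *)

Section TriangularDecomposition.
Variables (K : numFieldType) (m : nat) (A : 'M[int]_m) (h : realization K A).
Variable g : kacMoody h.

Local Notation br := (@lie_br K g).
Local Notation H := (km_h g).
Local Notation e := (km_e g).
Local Notation f := (km_f g).

Definition nplus : g -> Prop := eclos g (fun x => exists i, x = e i).

Lemma nplus_h t x : nplus x -> nplus (br (H t) x).
Proof.
by apply: eclos_h => y [i ->]; exists (sroot i) => u; exact: km_he.
Qed.

Lemma nplus_f j x : nplus x -> exists t y, nplus y /\ br (f j) x = H t + y.
Proof.
have Hl := km_h_linear g.
elim=> {x} [|x [i ->]|i x Nx [t [y [Ny E]]]|
  a x y _ [t [z [Nz E]]] _ [t' [z' [Nz' E']]]].
- exists 0, 0; split; first exact: eclos0.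
  by rewrite (lin0 Hl) addr0 (lin0 (lie_linearr _)).
- exists (if i == j then - scoroot h i else 0), 0; split; first exact: eclos0.
  rewrite addr0 lie_anti km_ef; case: eqP => _; first by rewrite (linN Hl).
  by rewrite oppr0 (lin0 Hl).
- exists 0, (br (f j) (br (e i) x)); split; last by rewrite (lin0 Hl) add0r.
  rewrite lie_der; apply: eclosD.
    rewrite [br (f j) (e i)]lie_anti km_ef (linN (lie_linearl _)).
    apply: eclosN.
    case: eqP => _; first exact: nplus_h.
    by rewrite (lin0 (lie_linearl _)); exact: eclos0.
  rewrite E (linD (lie_linearr _)); apply: eclosD; last exact: eclosE.
  rewrite lie_anti km_he -scaleNr; apply: eclosZ; apply: eclosX.
  by exists i.
- exists (a *: t + t'), (a *: z + z'); split; first exact: eclosL.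
  by rewrite (lie_linearr _) E E' Hl scalerDr addrACA.
Qed.

Lemma nplus_spec rho x : (forall j, sroot j rho = 1) -> nplus x ->
  spec_in g rho (natge 1) x.
Proof.
move=> rho1; apply: eclos_spec => // [c [k k1 ->]|y [i ->]].
  by exists k.+1; rewrite ?natr1 //; lia.
by apply: (@spec_in_eigen _ _ _ _ _ _ _ 1); [rewrite km_he rho1|exists 1%N].
Qed.

(** Isolates the part of height one: a bracket $[e_i,x]$ with $x\in\mathfrak n_+$ has height at
    least two. *)
Lemma nplus_simple rho x : (forall j, sroot j rho = 1) -> nplus x ->
  exists c : 'I_m -> K, spec_in g rho (natge 2) (x - \sum_i c i *: e i).
Proof.
move=> rho1; have [I0 IL] := spec_in_subspace g rho (@natge K 2).
elim=> {x} [|x [i ->]|i x Nx _|a x y _ [c IHx] _ [d IHy]].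
- by exists (fun=> 0); rewrite big1 ?subr0 // => i _; rewrite scale0r.
- exists (fun j => (j == i)%:R); rewrite (bigD1 i) //= eqxx scale1r.
  rewrite big1 ?addr0 ?subrr //.
  by move=> j ji; rewrite (negPf ji) scale0r.
- exists (fun=> 0); rewrite big1 ?subr0 => [|j _]; last by rewrite scale0r.
  apply: spec_in_shift (nplus_spec rho1 Nx) => [|c [k k1 ->]].
    by rewrite km_he; exact: erefl.
  by exists k.+1; rewrite ?rho1 ?natr1 //; lia.
- exists (fun i => a * c i + d i).
  have -> : a *: x + y - \sum_i (a * c i + d i) *: e i =
      a *: (x - \sum_i c i *: e i) + (y - \sum_i d i *: e i).
    rewrite scalerBr addrACA; congr (_ + _); rewrite -opprD; congr (- _).
    rewrite scaler_sumr -big_split; apply: eq_bigr => i _.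
    by rewrite scalerDl scalerA.
  exact: IL.
Qed.

End TriangularDecomposition.

Arguments nplus {K m A h} g _.

(** * Triangular decomposition and simple root spaces *)

Section RootSpaces.
Variables (K : numFieldType) (m : nat) (A : 'M[int]_m) (h : realization K A).
Variable g : kacMoody h.

Local Notation br := (@lie_br K g).
Local Notation H := (km_h g).
Local Notation e := (km_e g).
Local Notation f := (km_f g).
Local Notation nminus := (nplus (opp_kacMoody g)).

(** The sum $\mathfrak n_-+\mathfrak h+\mathfrak n_+$ is stable under the generators, hence under
    the whole algebra by [gen_stable], and it contains the generators. *)
Lemma triangular (y : g) : exists a t b,
  [/\ nminus a, nplus g b & y = a + H t + b].
Proof.
have Hl := km_h_linear g.
pose T y := exists a t b, [/\ nminus a, nplus g b & y = a + H t + b].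
have Tm a : nminus a -> T a.
  by exists a, 0, 0; rewrite (lin0 Hl) !addr0; split=> //; exact: eclos0.
have Tp b : nplus g b -> T b.
  by exists 0, 0, b; rewrite (lin0 Hl) !add0r; split=> //; exact: eclos0.
have Th t : T (H t).
  by exists 0, t, 0; rewrite add0r addr0; split=> //; exact: eclos0.
have Ts : is_subspace T.
  split; first by apply: (Tp); exact: eclos0.
  move=> c _ _ [a [t [b [Na Nb ->]]]] [a' [t' [b' [Na' Nb' ->]]]].
  exists (c *: a + a'), (c *: t + t'), (c *: b + b').
  split; [exact: eclosL|exact: eclosL|].
  rewrite Hl !scalerDr -!addrA; congr (_ + _).
  rewrite (addrCA (c *: b) a') (addrCA _ a'); congr (_ + (_ + _)).
  exact: addrCA.
have TD u v : T u -> T v -> T (u + v).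
  by move=> Tu Tv; rewrite -[u]scale1r; apply: Ts.2.
have TZ c u : T u -> T (c *: u).
  by move=> Tu; rewrite -[_ *: _]addr0; apply: Ts.2 => //; exact: Ts.1.
have Tst y' x : T x -> T (br y' x).
  apply: gen_stable y' x => //.
  - move=> s x [a [t [b [Na Nb ->]]]]; rewrite !(linD (lie_linearr _)) km_hh.
    rewrite addr0; apply: (TD); last by apply: (Tp); exact: nplus_h.
    by apply: (Tm); exact: (nplus_h (g := opp_kacMoody g)).
  - move=> i x [a [t [b [Na Nb ->]]]]; rewrite !(linD (lie_linearr _)).
    apply: (TD); last by apply: (Tp); exact: eclosE.
    apply: (TD).
      have [s [z [Nz ->]]] := nplus_f (g := opp_kacMoody g) i Na.
      by apply: (TD); [exact: Th|exact: Tm].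
    rewrite lie_anti km_he -scaleNr; apply/TZ/Tp.
    by apply: eclosX; exists i.
  - move=> i x [a [t [b [Na Nb ->]]]]; rewrite !(linD (lie_linearr _)).
    apply: (TD); first apply: (TD).
    + by apply: (Tm); exact: (eclosE (g := opp_kacMoody g)).
    + rewrite lie_anti km_hf -scaleNr; apply/TZ/Tm.
      by apply: eclosX; exists i.
    + have [s [z [Nz ->]]] := nplus_f i Nb.
      by apply: (TD); [exact: Th|exact: Tp].
apply: (km_generated (k := g) (S := T)) => //.
- by split=> // x z _ Tz; exact: Tst.
- by move=> i; apply: (Tp); apply: eclosX; exists i.
- by move=> i; apply: (Tm); apply: eclosX; exists i.
Qed.

(** In the opposite algebra height is measured by $-\rho$, so eigenvalues change sign. *)
Lemma spec_in_opp rho I J y : (forall c, I c -> J (- c)) ->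
  spec_in (opp_kacMoody g) (- rho) I y -> spec_in g rho J y.
Proof.
move=> IJ [s sI sy]; exists [seq - c | c <- s] => [c /mapP[b /sI/IJ ? ->] //|].
suff E : shift_ads (g := opp_kacMoody g) (- rho) s y =
    (-1) ^+ size s *: shift_ads (g := g) rho [seq - c | c <- s] y.
  by move/eqP: sy; rewrite E scaler_eq0 signr_eq0 => /eqP.
elim: s {sI sy} => [|c s IH]; first by rewrite scale1r.
rewrite /= IH (linZ (shift_ad_linear _ _)) exprS mulN1r scaleNr -scalerN.
congr (_ *: _); rewrite /shift_ad /= (linN (km_h_linear g)).
by rewrite (linN (lie_linearl _)) scaleNr opprK opprD.
Qed.

(** After subtracting a combination of the $e_j$, the triangular decomposition of $y$ has heights at
    most $-1$, $0$ and at least $2$, while the difference still has height $1$; so it is zero. The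
    coweight [om i] then singles out $e_i$. *)
Lemma simple_root_space i (y : g) :
  (forall t, br (H t) y = sroot i t *: y) -> exists c, y = c *: e i.
Proof.
move=> yi; have [om omE] := fund_dual h.
have [rho rho1] := height_coweight h.
have [a [t [b [Na Nb yE]]]] := triangular y.
have [c bc] := nplus_simple rho1 Nb.
pose w := y - \sum_j c j *: e j.
have w1 : br (H rho) w = 1 *: w.
  rewrite /w (linB (lie_linearr _)) yi rho1 scalerBr; congr (_ - _).
  rewrite (lin_sum (lie_linearr _)) scaler_sumr; apply: eq_bigr => j _.
  by rewrite (linZ (lie_linearr _)) km_he rho1 !scale1r.
have w0 : w = 0.
  apply: (eigen_spec_out w1 (I := fun c => c <> 1)); first by apply.
  have -> : w = a + H t + (b - \sum_j c j *: e j) by rewrite /w yE addrA.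
  apply: spec_inD; first apply: spec_inD.
  - have ra j : sroot (r := opp_realization h) j (- rho) = 1.
      by rewrite /= (linfN (sroot_linear _)) opprK rho1.
    apply: spec_in_opp (nplus_spec ra Na) => _ [k k1 ->] /esym/eqP.
    by rewrite -addr_eq0 nat1r pnatr_eq0.
  - apply: (@spec_in_eigen _ _ _ _ _ _ _ 0); first by rewrite km_hh scale0r.
    by apply/eqP; rewrite eq_sym oner_eq0.
  - apply: spec_in_mono bc => _ [k k2 ->] /eqP.
    by rewrite pnatr_eq1; lia.
exists (c i).
have yE' : y = \sum_j c j *: e j by apply/eqP; rewrite -subr_eq0 -/w w0.
have := yi (om i); rewrite omE eqxx scale1r => <-.
rewrite {1}yE' (lin_sum (lie_linearr _)) (bigD1 i) //= big1 ?addr0 => [|j ji].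
  by rewrite (linZ (lie_linearr _)) km_he omE eqxx scale1r.
by rewrite (linZ (lie_linearr _)) km_he omE eq_sym (negPf ji) scale0r scaler0.
Qed.

Hypothesis Aii : forall i, A i i = 2.
Hypothesis Aij : forall i j, i != j -> A i j <= 0.
Hypothesis A0 : forall i j, A i j = 0 -> A j i = 0.

Lemma ad_f_nilpotent i (y : g) : exists N, iter N (lie_br (f i)) y = 0.
Proof. exact: (@ad_e_nilpotent _ _ _ _ (opp_kacMoody g)). Qed.

End RootSpaces.

(** * Reflections of real roots *)

Section SmallExponentials.
Variables (K : numFieldType) (V : lmodType K) (D : V -> V).
Hypotheses (Dl : linear D) (Dnil : forall v, exists N, iter N D v = 0).

Lemma lexp2 v : D (D v) = 0 -> lexp Dnil v = v + D v.
Proof.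
move=> v0; rewrite (@lexpE _ _ _ Dl Dnil 2 v v0) !big_ord_recl big_ord0 addr0.
by rewrite /divpow /= fact0 factS fact0 invr1 !scale1r.
Qed.

Lemma lexp3 v : D (D (D v)) = 0 ->
  lexp Dnil v = v + (D v + 2^-1 *: D (D v)).
Proof.
move=> v0; rewrite (@lexpE _ _ _ Dl Dnil 3 v v0) !big_ord_recl big_ord0 addr0.
by rewrite /divpow /= !factS fact0 invr1 !scale1r.
Qed.

End SmallExponentials.

Section Reflections.
Variables (K : numFieldType) (m : nat) (A : 'M[int]_m) (h : realization K A).
Variables (g : kacMoody h) (V : lieModule g).

Local Notation br := (@lie_br K g).
Local Notation H := (km_h g).
Local Notation ad_nilpotent := (@locally_nilpotent _ _ _ _ g (adjoint g)).
Local Notation nilpotent := (@locally_nilpotent _ _ _ _ g V).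

(** The module map intertwines the action with its twist by the automorphism, so local nilpotency is
    transported on both sides. *)
Record compatible_aut (s : g -> g) (S : V -> V) : Prop := CompatibleAut {
  aut_lin : linear s;
  aut_lin_mod : linear S;
  aut_inj : injective s;
  aut_surj : forall y, exists x, s x = y;
  aut_surj_mod : forall w, exists v, S v = w;
  aut_br : forall x y, s (br x y) = br (s x) (s y);
  aut_act : forall x v, S (lact x v) = lact (s x) (S v)
}.

Lemma compatible_aut_comp s S s' S' : compatible_aut s S ->
  compatible_aut s' S' -> compatible_aut (s \o s') (S \o S').
Proof.
move=> [l L i j J b a] [l' L' i' j' J' b' a']; split.
- by move=> c u v; rewrite /= l' l.
- by move=> c u v; rewrite /= L' L.
- exact: inj_comp.
- by move=> y; have [x <-] := j y; have [z <-] := j' x; exists z.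
- by move=> y; have [x <-] := J y; have [z <-] := J' x; exists z.
- by move=> x y; rewrite /= b' b.
- by move=> x v; rewrite /= a' a.
Qed.

Lemma lexp_compatible x (nx : ad_nilpotent x) (Nx : nilpotent x) :
  compatible_aut (lexp nx) (lexp Nx).
Proof.
split.
- exact: lexp_linear (lie_linearr _) nx.
- exact: lexp_linear (lact_linearr _) Nx.
- exact: lexp_inj (lie_linearr _) nx.
- exact: lexp_surj (lie_linearr _) nx.
- exact: lexp_surj (lact_linearr _) Nx.
- apply: lexp_mul (@lie_linearl K g) (@lie_linearr K g) _ _ _ _;
    try exact: lie_linearr.
  exact: lie_der.
- apply: lexp_mul (@lact_linearl K g V) (@lact_linearr K g V) _ _ _ _;
    try exact: lact_linearr; try exact: lie_linearr.
  exact: lact_der.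
Qed.

Lemma nilpotent_opp (U : lieModule g) x :
  @locally_nilpotent _ _ _ _ g U x -> @locally_nilpotent _ _ _ _ g U (- x).
Proof.
move=> Nx v; have [N vN] := Nx v; exists N.
suff -> : iter N (lact (- x)) v = (-1) ^+ N *: iter N (lact x) v.
  by rewrite vN scaler0.
elim: N {vN} => [|N IH]; first by rewrite scale1r.
rewrite /= IH (linZ (lact_linearr _)) (linN (lact_linearl _)) scalerN exprS.
by rewrite mulN1r scaleNr.
Qed.

(** Nilpotency on algebra and module makes the exponentials available. One-dimensionality of the
    root space is carried along because the root vector in the theorem is arbitrary. *)
Record real_triple (beta : cartan h -> K) (b : cartan h) (e f : g) : Prop :=
    RealTriple {
  rt_two : beta b = 2;
  rt_ef : br e f = H b;
  rt_he : forall t, br (H t) e = beta t *: e;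
  rt_hf : forall t, br (H t) f = - beta t *: f;
  rt_dim1 : forall x, (forall t, br (H t) x = beta t *: x) ->
    exists c, x = c *: e;
  rt_ade : ad_nilpotent e;
  rt_adf : ad_nilpotent f;
  rt_e : nilpotent e;
  rt_f : nilpotent f
}.

Definition real_root beta b := exists e f, real_triple beta b e f.

Section Transport.
Variables (s : g -> g) (S : V -> V) (r : cartan h -> cartan h).
Hypotheses (sS : compatible_aut s S) (sr : forall t, s (H t) = H (r t)).
Hypothesis rK : involutive r.

Lemma ad_nilpotent_aut x : ad_nilpotent x -> ad_nilpotent (s x).
Proof.
move=> Nx y; have [z <-] := aut_surj sS y; have [N zN] := Nx z; exists N.
suff -> : iter N (lact (l := adjoint g) (s x)) (s z) = s (iter N (br x) z).
  by rewrite [X in s X]zN (lin0 (aut_lin sS)).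
elim: N {zN} => // N IH; rewrite iterS IH; exact/esym/(aut_br sS).
Qed.

Lemma nilpotent_aut x : nilpotent x -> nilpotent (s x).
Proof.
move=> Nx y; have [z <-] := aut_surj_mod sS y; have [N zN] := Nx z; exists N.
suff -> : iter N (lact (s x)) (S z) = S (iter N (lact x) z).
  by rewrite zN (lin0 (aut_lin_mod sS)).
by elim: N {zN} => //= N ->; rewrite (aut_act sS).
Qed.

Lemma weight_aut t x a : br (H (r t)) x = a *: x -> br (H t) (s x) = a *: s x.
Proof.
move=> xa; rewrite -[in LHS](rK t) -sr -(aut_br sS) xa.
exact: linZ (aut_lin sS) _ _.
Qed.

(** Since [r] is an involution, the transported root $\beta\circ r^{-1}$ is $\beta\circ r$. *)
Lemma real_triple_aut beta b e f : real_triple beta b e f ->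
  real_triple (beta \o r) (r b) (s e) (s f).
Proof.
move=> [t2 tef the thf td tae taf te tf]; split.
- by rewrite /= rK.
- by rewrite -(aut_br sS) tef sr.
- by move=> t; apply: weight_aut.
- by move=> t; apply: weight_aut.
- move=> x; have [y <-] := aut_surj sS x => yx.
  have [|c ->] := td y; last by exists c; rewrite (linZ (aut_lin sS)).
  move=> t; apply: (aut_inj sS); rewrite (aut_br sS) sr yx /= rK.
  by rewrite (linZ (aut_lin sS)).
- exact: ad_nilpotent_aut.
- exact: ad_nilpotent_aut.
- exact: nilpotent_aut.
- exact: nilpotent_aut.
Qed.

End Transport.

(* exp(e) exp(-f) exp(e) induces the reflection of the Cartan subalgebra.    *)
Lemma reflection_aut gamma c e f : real_triple gamma c e f ->
  exists s S, compatible_aut s S /\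
    forall t, s (H t) = H (t - gamma t *: c).
Proof.
move=> [t2 tef the thf _ tae taf te tf].
have Hl := km_h_linear g.
have naf : ad_nilpotent (- f) := nilpotent_opp taf.
have nf : nilpotent (- f) := nilpotent_opp tf.
exists (lexp tae \o (lexp naf \o lexp tae)), (lexp te \o (lexp nf \o lexp te)).
split; first by do !apply: compatible_aut_comp; exact: lexp_compatible.
have Ll x nx : linear (@lexp K g (br x) nx) := lexp_linear (lie_linearr _) nx.
have eh t : br e (H t) = - gamma t *: e by rewrite lie_anti the scaleNr.
have fh t : br (- f) (H t) = - gamma t *: f.
  by rewrite (linN (lie_linearl _)) -lie_anti thf.
have fe : br (- f) e = H c by rewrite (linN (lie_linearl _)) -lie_anti.
have ff : br (- f) f = 0 by rewrite (linN (lie_linearl _)) lie_alt oppr0.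
have Eh t : lexp tae (H t) = H t - gamma t *: e.
  rewrite (lexp2 (lie_linearr _)) /= ?eh ?scaleNr //.
  rewrite (linN (lie_linearr _)) (linZ (lie_linearr _)) lie_alt.
  by rewrite scaler0 oppr0.
have Ee : lexp tae e = e.
  rewrite (lexp2 (lie_linearr _)) /= lie_alt ?addr0 //.
  exact: lin0 (lie_linearr _).
have Fh t : lexp naf (H t) = H t - gamma t *: f.
  rewrite (lexp2 (lie_linearr _)) /= ?fh ?scaleNr //.
  by rewrite (linN (lie_linearr _)) (linZ (lie_linearr _)) ff scaler0 oppr0.
have Fe : lexp naf e = e + (H c - f).
  rewrite (lexp3 (lie_linearr _)) /= fe fh t2.
    by rewrite scalerA mulrN mulVf ?pnatr_eq0 // scaleN1r.
  by rewrite (linZ (lie_linearr _)) ff scaler0.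
(* The successive images of $H_t$ are $H_t-\gamma(t)e$, then $H_t-\gamma(t)e-\gamma(t)H_c$, then
   $H_t-\gamma(t)H_c$. *)
move=> t; rewrite /= Eh (linB (Ll _ _)) (linZ (Ll _ _)) Fh Fe.
have -> : H t - gamma t *: f - gamma t *: (e + (H c - f)) =
    H t - gamma t *: e - gamma t *: H c.
  by rewrite scalerDr scalerBr [_ + (_ - _)]addrA opprB addrA subrK opprD addrA.
rewrite !(linB (Ll _ _)) !(linZ (Ll _ _)) !Eh Ee t2.
rewrite (linB Hl) (linZ Hl) scalerBr opprB scalerA mulr_natr mulr2n scalerDl.
by rewrite addrA -(addrA (H t)) -opprD subrK.
Qed.

Lemma real_root_reflection beta b gamma c : linear_for *%R beta ->
  linear_for *%R gamma -> real_root beta b -> real_root gamma c ->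
  real_root (fun t => beta t - beta c * gamma t) (b - gamma b *: c).
Proof.
move=> bl gl [e [f T]] [e' [f' T']].
have [s [S [sS sr]]] := reflection_aut T'.
have rK : involutive (fun t => t - gamma t *: c).
  move=> t; rewrite (linfB gl) (linfZ gl) (rt_two T') mulr_natr mulr2n opprD.
  by rewrite addrA subrr add0r scaleNr opprK subrK.
exists (s e), (s f).
have [t2 tef the thf td tae taf te tf] := real_triple_aut sS sr rK T.
have E t : beta (t - gamma t *: c) = beta t - beta c * gamma t.
  by rewrite (linfB bl) (linfZ bl) mulrC.
split=> //.
- by rewrite -E.
- by move=> t; rewrite -E the.
- by move=> t; rewrite -E thf.
- by move=> x xt; apply: td => t; rewrite xt -E.
Qed.

Lemma real_root_ext beta beta' b : beta =1 beta' -> real_root beta b ->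
  real_root beta' b.
Proof.
move=> E [e [f [t2 tef the thf td tae taf te tf]]]; exists e, f; split=> //.
- by rewrite -E.
- by move=> t; rewrite -E.
- by move=> t; rewrite -E.
- by move=> x xt; apply: td => t; rewrite E.
Qed.

Lemma real_root_simple i : (forall i, A i i = 2) ->
  (forall i j, i != j -> A i j <= 0) -> (forall i j, A i j = 0 -> A j i = 0) ->
  integrable_module g V -> real_root (sroot i) (scoroot h i).
Proof.
move=> A2 Aneg A0 [_ /(_ i)[Ne Nf]]; exists (km_e g i), (km_f g i); split=> //.
- by rewrite sroot_scoroot A2.
- by rewrite km_ef eqxx.
- by move=> t; rewrite km_he.
- by move=> t; rewrite km_hf.
- exact: simple_root_space.
- exact: ad_e_nilpotent.
- exact: ad_f_nilpotent.
Qed.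

(** The root space being a line, $e$ is a nonzero multiple of the vector $e'$ of the triple, so
    nonvanishing of $e'^kv$, given by [sl2_iter_neq0], passes to $e^kv$. *)
Lemma real_root_string beta b mu (v : V) e p k : real_root beta b ->
  root_vector g beta e -> weight_vector g mu v -> mu b = - p%:R ->
  (k <= p)%N ->
  weight_vector g (fun t => mu t + k%:R * beta t) (iter k (lact e) v).
Proof.
move=> [e' [f' T]] [e0 he] [v0 hv] mub kp; split; last first.
  move=> t; elim: k {kp} => [|k IH]; first by rewrite mul0r addr0 hv.
  rewrite iterS lact_der he IH (linZ (lact_linearl _)) (linZ (lact_linearr _)).
  by rewrite -scalerDl; congr (_ *: _); rewrite -natr1; ring.
have [c ec] := rt_dim1 T he.
have c0 : c != 0 by apply: contraNneq e0 => c0; rewrite ec c0 scale0r.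
have -> : iter k (lact e) v = c ^+ k *: iter k (lact e') v.
  elim: k {kp} => [|k IH]; first by rewrite scale1r.
  rewrite /= IH (linZ (lact_linearr _)) ec (linZ (lact_linearl _)) scalerA.
  by rewrite exprSr.
rewrite scaler_eq0 expf_eq0 (negPf c0) andbF /=.
apply: (sl2_iter_neq0 (rt_ef T) _ _ (m := p)) => //.
- by rewrite (rt_he T) (rt_two T).
- by rewrite (rt_hf T) (rt_two T).
- by rewrite hv mub.
- exact: rt_f T v.
Qed.

End Reflections.

(** * Irreducible root systems *)

Lemma ipairC n (x a : 'rV[int]_n) : ipair x a = ipair a x.
Proof. by rewrite !ipairE; apply: eq_bigr => k _; rewrite mulrC. Qed.

Lemma ipairNl n (x a : 'rV[int]_n) : ipair (- x) a = - ipair x a.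
Proof. by rewrite -scaleN1r ipairZl mulN1r. Qed.

Lemma ipairNr n (x a : 'rV[int]_n) : ipair x (- a) = - ipair x a.
Proof. by rewrite -scaleN1r ipairZr mulN1r. Qed.

Section RootCombinatorics.
Variables (n : nat) (D : rootDatum n).
Local Notation co := (coroot D).
Local Notation Phi := (Defs.roots D).
Implicit Types a b c x y : 'rV[int]_n.

Definition refl a c := c - ipair (co a) c *: a.
Definition corefl a x := x - ipair x a *: co a.

Lemma ipair_corefl a x c : ipair (corefl a x) c = ipair x (refl a c).
Proof. by rewrite ipairDl ipairDr ipairNl ipairNr ipairZl ipairZr mulrC. Qed.

Lemma refl_root a b : a \in Phi -> b \in Phi -> refl a b \in Phi.
Proof. exact: root_refl. Qed.

Lemma refl_self a : a \in Phi -> refl a a = - a.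
Proof.
move=> aR; rewrite /refl coroot_root // scaler_nat mulr2n opprD.
by rewrite addrA subrr add0r.
Qed.

Lemma ipair_refl a c : a \in Phi ->
  ipair (co a) (refl a c) = - ipair (co a) c.
Proof.
move=> aR; rewrite ipairDr ipairNr ipairZr coroot_root // mulr_natr mulr2n.
by rewrite opprD addrA subrr add0r.
Qed.

Lemma reflK a : a \in Phi -> involutive (refl a).
Proof.
by move=> aR c; rewrite {1}/refl ipair_refl // scaleNr opprK subrK.
Qed.

Lemma opp_root a : a \in Phi -> - a \in Phi.
Proof. by move=> aR; rewrite -refl_self //; exact: refl_root. Qed.

Lemma refl_sum (F : 'rV[int]_n -> int) a : a \in Phi ->
  \sum_(c <- undup (Phi)) F (refl a c) = \sum_(c <- undup (Phi)) F c.
Proof.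
move=> aR; rewrite -(big_map (refl a) xpredT F); apply: perm_big.
apply: uniq_perm; rewrite ?undup_uniq //.
  by rewrite map_inj_uniq ?undup_uniq //; exact: inv_inj (reflK aR).
move=> c; apply/mapP/idP => [[b]|]; rewrite !mem_undup.
  by move=> bR ->; exact: refl_root.
by move=> cR; exists (refl a c); rewrite ?mem_undup ?reflK //; exact: refl_root.
Qed.

(** A Weyl-invariant form, positive on coroots; it compares $\langle\check a,b\rangle$ with
    $\langle\check b,a\rangle$. *)
Definition cform x y : int := \sum_(c <- undup (Phi)) ipair x c * ipair y c.

Lemma cformC x y : cform x y = cform y x.
Proof. by apply: eq_bigr => c _; rewrite mulrC. Qed.

Lemma cform_corefl a x y : a \in Phi ->
  cform (corefl a x) y = cform x (corefl a y).
Proof.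
move=> aR; rewrite /cform -(refl_sum _ aR); apply: eq_bigr => c _.
by rewrite !ipair_corefl reflK.
Qed.

Lemma cform_coroot a y : a \in Phi ->
  2 * cform (co a) y = ipair y a * cform (co a) (co a).
Proof.
move=> aR; have : cform (co a) y =
    - cform (co a) y + ipair y a * cform (co a) (co a).
  rewrite {1}/cform -(refl_sum _ aR) mulr_sumr -sumrN -big_split /=.
  apply: eq_bigr => c _; rewrite ipair_refl // ipairDr ipairNr ipairZr; ring.
lia.
Qed.

Lemma cform_gt0 a : a \in Phi -> 0 < cform (co a) (co a).
Proof.
move=> aR; rewrite /cform (bigD1_seq a) ?mem_undup ?undup_uniq //=.
rewrite coroot_root // ltr_wpDr //.
by apply: sumr_ge0 => c _; rewrite -expr2 sqr_ge0.
Qed.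

Lemma ipair_swap a b : a \in Phi -> b \in Phi ->
  ipair (co a) b * cform (co b) (co b) = ipair (co b) a * cform (co a) (co a).
Proof. by move=> aR bR; rewrite -!cform_coroot // cformC. Qed.

Lemma ipair_gt0C a b : a \in Phi -> b \in Phi ->
  (0 < ipair (co a) b) = (0 < ipair (co b) a).
Proof.
move=> aR bR; rewrite -(pmulr_lgt0 _ (cform_gt0 bR)) ipair_swap //.
by rewrite pmulr_lgt0 // cform_gt0.
Qed.

Lemma ipair_eq0C a b : a \in Phi -> b \in Phi ->
  (ipair (co a) b == 0) = (ipair (co b) a == 0).
Proof.
move=> aR bR; have := ipair_swap aR bR.
have := cform_gt0 aR; have := cform_gt0 bR; nia.
Qed.

(** The axiom only provides some root $c$ with coroot $s_a\check b$. By [cform_coroot] and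
    invariance, $c$ and $s_ab$ pair proportionally with all coweights; pairing with $\check c$ shows
    that the factor is $1$, so $c=s_ab$. *)
Lemma coroot_reflE a b : a \in Phi -> b \in Phi ->
  co (refl a b) = corefl a (co b).
Proof.
move=> aR bR; have [c cR cE] := coroot_refl aR bR.
rewrite -/(corefl a (co b)) in cE; rewrite -cE; congr co; apply/esym.
have yc y : ipair y c * cform (co c) (co c) =
    ipair y (refl a b) * cform (co b) (co b).
  rewrite -cform_coroot // [in LHS]cE cform_corefl // cform_coroot //.
  by rewrite ipair_corefl.
have cb : cform (co c) (co c) = cform (co b) (co b).
  have := yc (co c); rewrite [in X in _ = X * _]cE ipair_corefl reflK //.
  by rewrite !coroot_root //; lia.
apply/rowP => i; have := yc (delta_mx 0 i).
rewrite cb ![ipair (delta_mx 0 i) _]ipairC !ipair_delta => /mulIf -> //.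
by rewrite gt_eqF // cform_gt0.
Qed.

Lemma coroot_opp a : a \in Phi -> co (- a) = - co a.
Proof.
move=> aR; rewrite -refl_self // coroot_reflE // /corefl coroot_root //.
by rewrite scaler_nat mulr2n opprD addrA subrr add0r.
Qed.

Lemma simple_root_in i : simple_root i \in Phi.
Proof. exact: simple_is_root. Qed.

(** Induction on height: a positive root pairs positively with some simple coroot, and that simple
    reflection lowers its height. A negative root $a$ is the reflection of $-a$ in itself. *)
Lemma root_gen (P : 'rV[int]_n -> Prop) :
  (forall i, P (simple_root i)) ->
  (forall a b, a \in Phi -> b \in Phi -> P a -> P b -> P (refl a b)) ->
  forall a, a \in Phi -> P a.
Proof.
move=> Psimple Prefl.
have Ppos N a : a \in Phi -> (forall i, 0 <= a 0 i) ->
    \sum_i a 0 i <= N%:Z -> P a.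
  elim: N a => [|N IH] a aR apos aN.
    have a0 : a = 0.
      apply/rowP => i; rewrite mxE; move: aN; rewrite (bigD1 i) //=.
      have : 0 <= \sum_(j | j != i) a 0 j by apply: sumr_ge0.
      by set S := \sum_(j | _) _; have := apos i; lia.
    by have := coroot_root aR; rewrite {2}a0 -(scale0r 0) ipairZr mul0r.
  (* The products $a_i\check a_i$ sum to $\langle\check a,a\rangle=2$, so one of them is
     positive. *)
  have [i ai] : exists i, 0 < a 0 i * co a 0 i.
    apply/existsP; apply: contraT; rewrite negb_exists => /forallP a0.
    have : ipair (co a) a <= 0.
      by rewrite ipairE; apply: sumr_le0 => i _; have := a0 i; lia.
    by rewrite coroot_root.
  have ai0 : 0 < a 0 i.
    by rewrite lt_def apos andbT; apply: contraTneq ai => ->; rewrite mul0r.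
  have coai : 0 < co a 0 i by move: ai; rewrite pmulr_rgt0.
  have kpos : 0 < ipair (co (simple_root i)) a.
    by rewrite ipair_gt0C ?simple_root_in // ipair_delta.
  set k := ipair _ _ in kpos; pose b := refl (simple_root i) a.
  have bR : b \in Phi by apply: refl_root => //; exact: simple_root_in.
  have bE j : b 0 j = a 0 j - k * (j == i)%:R.
    by rewrite !mxE eqxx.
  have aE : a = refl (simple_root i) b by rewrite reflK // simple_root_in.
  have [bpos|bneg] := root_pos_or_neg bR.
    rewrite aE; apply: Prefl => //; first exact: simple_root_in.
    apply: IH => //; under eq_bigr do rewrite bE.
    rewrite sumrB -mulr_sumr [X in _ * X](bigD1 i) //= eqxx.
    rewrite [\sum_(j | j != i) _]big1 => [|j ji].
      by rewrite addr0 mulr1; move: aN kpos; set S := \sum_(j < n) _; lia.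
    by rewrite (negPf ji).
  (* Only coordinate $i$ has changed, so a negative image forces $a=a_i\alpha_i$. Then $a_i\check
     a_i=2$ gives $a_i\in\{1,2\}$, and $2$ contradicts reducedness. *)
  have aj j : j != i -> a 0 j = 0.
    by move=> ji; have := bneg j; have := apos j; rewrite bE (negPf ji); lia.
  have ad : a = a 0 i *: simple_root i.
    apply/rowP => j; rewrite !mxE eqxx /=; have [->|ji] := eqVneq j i.
      by rewrite mulr1.
    by rewrite mulr0 aj.
  have := coroot_root aR; rewrite {2}ad ipairZr ipair_delta => a2.
  have : a 0 i = 1 \/ a 0 i = 2 by nia.
  case=> ai12; first by rewrite ad ai12 scale1r.
  have := root_reduced (simple_root_in i).
  by rewrite -scaler_nat -[2%:R]/(2 : int) -ai12 -ad aR.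
move=> a aR; have [apos|aneg] := root_pos_or_neg aR.
  by apply: (Ppos (absz (\sum_i a 0 i))) => //; rewrite abszE ler_norm.
have naR := opp_root aR.
have Pna : P (- a).
  apply: (Ppos (absz (\sum_i (- a) 0 i))) => //; last by rewrite abszE ler_norm.
  by move=> i; rewrite mxE oppr_ge0.
by rewrite -[a]opprK -refl_self //; exact: Prefl.
Qed.

Inductive weyl_orbit a : 'rV[int]_n -> Prop :=
| orbit_self : weyl_orbit a a
| orbit_refl b c : b \in Phi -> weyl_orbit a c -> weyl_orbit a (refl b c).

Lemma weyl_orbit_root a c : a \in Phi -> weyl_orbit a c -> c \in Phi.
Proof. by move=> aR; elim=> // b {}c bR _; exact: refl_root. Qed.

(** Reflections are involutions, so a property they preserve can be pulled back along the orbit. *)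
Lemma weyl_orbit_ind_rev (P : 'rV[int]_n -> Prop) a c :
  (forall b c', b \in Phi -> c' \in Phi -> P c' -> P (refl b c')) ->
  a \in Phi -> weyl_orbit a c -> P c -> P a.
Proof.
move=> Pr aR; elim=> // b {}c bR ac IH Pc; apply: IH.
have cR := weyl_orbit_root aR ac.
by rewrite -(reflK bR c); apply: Pr => //; exact: refl_root.
Qed.

(* Otherwise the roots orthogonal to the orbit of [a] would separate [b]     *)
(* from [a] in the irreducible root system.                                  *)
Lemma weyl_orbit_nonorth a b : a \in Phi -> b \in Phi ->
  exists2 c, weyl_orbit a c & ipair (co b) c != 0.
Proof.
move=> aR bR; apply: contrapT => noc.
pose P : pred 'rV[int]_n := fun d =>
  `[< forall c, weyl_orbit a c -> ipair (co d) c = 0 >].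
have : P a.
  apply: (root_irreducible (r := D)) => //.
    exists b => //; apply/asboolP => c ac; apply/eqP/negPn/negP => bc.
    by apply: noc; exists c.
  move=> d d' dR d'R /asboolP Pd /asboolPn nPd'.
  apply: contrapT => dd'; apply: nPd' => c ac.
  have := Pd _ (orbit_refl d'R ac).
  rewrite ipairDr (Pd _ ac) ipairNr ipairZr add0r => /eqP.
  by rewrite oppr_eq0 mulf_eq0 => /orP[/eqP|/eqP].
by move/asboolP/(_ _ (orbit_self a)); rewrite coroot_root.
Qed.

(** A negative pairing is made positive by reflecting in $b$ itself. *)
Lemma weyl_orbit_pos a b : a \in Phi -> b \in Phi ->
  exists2 c, weyl_orbit a c & 0 < ipair (co b) c.
Proof.
move=> aR bR; have [c ac] := weyl_orbit_nonorth aR bR.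
rewrite neq_lt => /orP[c0|]; last by exists c.
exists (refl b c); first exact: orbit_refl.
by rewrite ipair_refl // oppr_gt0.
Qed.

(** * The highest root and the affine Cartan matrix *)

Section Highest.
Variable theta : 'rV[int]_n.
Hypothesis theta_high : highest_root D theta.

(** As $-s_\theta a=k\theta-a$ is a root, maximality gives $(k-1)\theta\le a\le\theta$
    coordinatewise. Hence $k\le2$, and $k=2$ forces $a=\theta$. *)
Lemma highest_ipair a : a \in Phi -> 0 < ipair (co theta) a ->
  a = theta \/ ipair (co theta) a = 1.
Proof.
move=> aR; case: (theta_high) => tR tmax; set k := ipair _ _ => k0.
have le i : (k - 1) * theta 0 i <= a 0 i.
  by have := tmax _ (opp_root (refl_root tR aR)) i; rewrite !mxE -/k; lra.
have t1 (i : 'I_n) : 1 <= theta 0 i.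
  by have := tmax _ (simple_root_in i) i; rewrite mxE !eqxx.
pose i0 := Ordinal (rank_gt0 D).
have := tmax _ aR; have [k1 _|kn1 amax] := eqVneq k 1; first by right.
left; apply/rowP => i; have k2 : k = 2.
  have : (k - 1) * theta 0 i0 <= 1 * theta 0 i0.
    by rewrite mul1r; exact: le_trans (le i0) (amax i0).
  by rewrite ler_pM2r; [move: kn1 k0; clear; lia|have := t1 i0; lia].
by apply/eqP; rewrite eq_le amax /=; apply: le_trans (le i); rewrite k2 mul1r.
Qed.

Lemma aff_root_in i : aff_root theta i \in Phi.
Proof.
rewrite /aff_root; case: unlift => [j|]; first exact: simple_root_in.
by apply: opp_root; case: theta_high.
Qed.

Lemma aff_corootE i : aff_coroot D theta i = co (aff_root theta i).
Proof.
rewrite /aff_root /aff_coroot; case: unlift => //.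
by rewrite coroot_opp //; case: theta_high.
Qed.

Lemma aff_pairing_diag i : ipair (aff_coroot D theta i) (aff_root theta i) = 2.
Proof. by rewrite aff_corootE coroot_root // aff_root_in. Qed.

Lemma aff_pairing_eq0 i j :
  ipair (aff_coroot D theta i) (aff_root theta j) = 0 ->
  ipair (aff_coroot D theta j) (aff_root theta i) = 0.
Proof.
move=> /eqP ij; apply/eqP; move: ij.
by rewrite !aff_corootE ipair_eq0C // aff_root_in.
Qed.

(** For two simple roots, a positive pairing would give the reflected root coordinates of both
    signs. For the affine vertex, $s_k\theta\le\theta$ gives
    $\langle\check\alpha_k,\theta\rangle\ge0$. *)
Lemma aff_pairing_le0 i j : i != j ->
  ipair (aff_coroot D theta i) (aff_root theta j) <= 0.
Proof.
have [tR tmax] := theta_high.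
have simple_theta k : 0 <= ipair (co (simple_root k)) theta.
  have := tmax _ (refl_root (simple_root_in k) tR) k.
  by rewrite !mxE !eqxx /= mulr1; lra.
rewrite leNgt; apply: contraNN; rewrite aff_corootE.
rewrite /aff_root; case: unliftP => [k|] ->; case: unliftP => [l|] -> //.
- move=> kl; apply: contraT => neq_kl.
  have kl' : l != k by apply: contra neq_kl => /eqP ->.
  have [] := root_pos_or_neg (refl_root (simple_root_in k) (simple_root_in l)).
    by move/(_ k); rewrite !mxE !eqxx eq_sym (negPf kl') /=; lia.
  by move/(_ l); rewrite !mxE !eqxx (negPf kl') /=; lia.
- by rewrite ipairNr; have := simple_theta k; lia.
- rewrite ipair_gt0C ?opp_root ?simple_root_in // ipairNr.
  by have := simple_theta l; lia.
Qed.

(** * The normalized form and the numbers $r_\alpha$ *)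

Variable B : 'M[rat]_n.
Hypothesis B_norm : normalized_root_form D B.

Lemma gramDr x y z : gram B x (y + z) = gram B x y + gram B x z.
Proof. by rewrite /gram map_mxD linearD mulmxDr mxE. Qed.

Lemma gramZr k x y : gram B x (k *: y) = k%:~R * gram B x y.
Proof. by rewrite /gram map_mxZ linearZ -scalemxAr mxE. Qed.

Lemma gramC x y : gram B x y = gram B y x.
Proof.
case: B_norm => [[Bs _] _]; rewrite /gram -[in RHS]Bs -[map_mx _ y]trmxK.
by rewrite -!trmx_mul mulmxA [RHS]mxE trmxK.
Qed.

Lemma gram_refl a x y : a \in Phi ->
  gram B (refl a x) (refl a y) = gram B x y.
Proof. by case: B_norm => [[_ Binv] _] aR; exact: Binv. Qed.

Lemma gram_coroot a x : a \in Phi ->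
  2 * gram B a x = (ipair (co a) x)%:~R * gram B a a.
Proof.
move=> aR; have := gram_refl a x aR; rewrite refl_self // gramC.
rewrite -scaleN1r gramZr gramC gramDr -scaleNr gramZr.
by rewrite !rmorphN /= => E; lra.
Qed.

(** Some long root is conjugate to a root $c$ with $\langle\check\theta,c\rangle>0$. If $c\ne\theta$
    the pairing is $1$, so $(\theta|\theta)=2m$ with $m=\langle\check c,\theta\rangle>0$, and
    maximality of the length forces $m=1$. *)
Lemma gram_highest : gram B theta theta = 2.
Proof.
have [tR _] := theta_high.
have [a [aR amax]] : exists a, long_root D B a.
  have : Phi != [::] by apply: contraTneq tR => ->.
  rewrite /long_root; elim: (Phi) => // r s IH _.
  have [->|/IH[a [aS amax]]] := eqVneq s [::].
    by exists r; split=> [|b]; rewrite inE // => /eqP ->.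
  have [ra|ar] := leP (gram B r r) (gram B a a).
    exists a; split=> [|b]; first by rewrite inE aS orbT.
    by rewrite inE => /orP[/eqP ->|/amax].
  exists r; split=> [|b]; first by rewrite inE eqxx.
  by rewrite inE => /orP[/eqP -> //|/amax/le_trans]; apply; exact: ltW.
have a2 : gram B a a = 2 by case: B_norm => _; apply.
have [c ac] := weyl_orbit_pos aR tR.
have cR := weyl_orbit_root aR ac.
have c2 : gram B c c = 2.
  by elim: ac => // b d bR _ <-; exact: gram_refl.
move=> c0; have [<- //|c1] := highest_ipair cR c0.
have := gram_coroot c tR; rewrite c1 mul1r gramC gram_coroot // c2 => tE.
have := amax _ tR; rewrite a2 -tE.
have : 0 < ipair (co c) theta by rewrite ipair_gt0C // c1.
set m := ipair _ _ => m0 m1; suff -> : m = 1 by rewrite mul1r.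
have : m%:~R <= 1%:~R :> rat by lra.
by rewrite ler_int; lia.
Qed.

Lemma rlength_highest : rlength B theta = 1.
Proof. by rewrite /rlength gram_highest divff. Qed.

Lemma rlength_refl a b : a \in Phi -> rlength B (refl a b) = rlength B b.
Proof. by move=> aR; rewrite /rlength gram_refl. Qed.

(** Computing $2(\theta|a)$ through either coroot gives $2=\langle\check a,\theta\rangle(a|a)$. *)
Lemma rlength_ipair a : a \in Phi -> ipair (co theta) a = 1 ->
  rlength B a = (ipair (co a) theta)%:~R.
Proof.
move=> aR a1; have [tR _] := theta_high.
have := gram_coroot a tR; rewrite a1 mul1r gram_highest gramC gram_coroot //.
move=> E; rewrite /rlength -{1}E mulfK //.
by apply: contra_eq_neq E => ->; rewrite mulr0.
Qed.

End Highest.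
End RootCombinatorics.

(** * Real roots of the dual affine algebra *)

Section DualWeights.
Variables (K : numFieldType) (n : nat).

Lemma wevalD (mu nu : dweight K n) x :
  weval (mu + nu) x = weval mu x + weval nu x.
Proof. by rewrite /weval /= mulmxDl mxE; ring. Qed.

Lemma wevalZ a (mu : dweight K n) x : weval (a *: mu) x = a * weval mu x.
Proof. by rewrite /weval /= -scalemxAl mxE /GRing.scale /=; ring. Qed.

Lemma map_ipair (y x : 'rV[int]_n) :
  ((map_mx intr y : 'rV[K]_n) *m (map_mx intr x)^T) 0 0 = (ipair y x)%:~R.
Proof.
rewrite mxE ipairE rmorph_sum; apply: eq_bigr => k _.
by rewrite /= !mxE rmorphM.
Qed.

Lemma weval_fin (y x : 'rV[int]_n) (a r s : K) :
  weval (map_mx intr y, a, r) (map_mx intr x, s, 0) = (ipair y x)%:~R + a * s.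
Proof. by rewrite /weval /= map_ipair mulr0 addr0. Qed.

End DualWeights.

Section AffineRealRoots.
Variables (K : numFieldType) (n : nat) (D : rootDatum n) (theta : 'rV[int]_n).
Hypothesis theta_high : highest_root D theta.
Variables (g : kacMoody (dual_affine D K theta)) (V : lieModule g).
Hypothesis V_int : integrable_module g V.

Local Notation co := (coroot D).
Local Notation Phi := (Defs.roots D).

(* y + r delta is a real root with coroot x + s c (c the central element).   *)
Definition aff_real (y : 'rV[int]_n) (r : K) (x : 'rV[int]_n) (s : K) :=
  real_root V (weval ((map_mx intr y, 0, r) : dweight K n))
    ((map_mx intr x, s, 0) : dcartan K n).

(** These roots have level $0$ and these coroots no $d$ component, so only the finite pairings
    enter. *)
Lemma aff_real_reflection y r x s y' r' x' s' :
  aff_real y r x s -> aff_real y' r' x' s' ->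
  aff_real (y - ipair y x' *: y') (r - (ipair y x')%:~R * r')
    (x - ipair y' x *: x') (s - (ipair y' x)%:~R * s').
Proof.
move=> T T'; have := @real_root_reflection _ _ _ _ g V _ _ _ _
  (weval_linear _) (weval_linear _) T T'.
rewrite !weval_fin !mul0r !addr0 => T2.
rewrite /aff_real !map_mxB !map_mxZ.
have -> : ((map_mx intr x - (ipair y' x)%:~R *: map_mx intr x',
    s - (ipair y' x)%:~R * s', 0) : dcartan K n) =
    ((map_mx intr x, s, 0) : dcartan K n) -
    (ipair y' x)%:~R *: ((map_mx intr x', s', 0) : dcartan K n).
  transitivity ((map_mx intr x - (ipair y' x)%:~R *: map_mx intr x',
    s - (ipair y' x)%:~R * s', 0 - (ipair y' x)%:~R * 0) : dcartan K n) => //.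
  by rewrite mulr0 subr0.
apply: real_root_ext T2 => t.
by rewrite /weval /= mulmxBl -scalemxAl !mxE; ring.
Qed.

Lemma aff_real_simple i : aff_real (aff_coroot D theta i)
  (unlift ord0 i == None)%:R (aff_root theta i) (unlift ord0 i == None)%:R.
Proof.
rewrite /aff_real -dual_srootE -dual_scorootE.
apply: (@real_root_simple _ _ _ _ g V i) => // [j|j k jk|j k].
- by rewrite !mxE aff_pairing_diag.
- by rewrite !mxE aff_pairing_le0 // eq_sym.
- by rewrite !mxE; exact: aff_pairing_eq0.
Qed.

Lemma aff_real_finite a : a \in Phi -> aff_real (co a) 0 a 0.
Proof.
move: a; apply: root_gen => [i|a b aR bR Ta Tb].
  by have := aff_real_simple (lift ord0 i); rewrite /aff_root /aff_coroot liftK.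
have := aff_real_reflection Tb Ta.
by rewrite !mulr0 !subr0 coroot_reflE.
Qed.

Variable B : 'M[rat]_n.
Hypothesis B_norm : normalized_root_form D B.

(** The real root $-\check a+r_a\check\delta$, with coroot $-a+\check c$. *)
Definition aff_real_down a := aff_real (- co a) (ratr (rlength B a)) (- a) 1.

(** A finite reflection changes neither the $\check\delta$ nor the $\check c$ component, and it
    preserves $r_a$. *)
Lemma aff_real_down_refl a b : b \in Phi -> a \in Phi -> aff_real_down a ->
  aff_real_down (refl D b a).
Proof.
move=> bR aR Ta; have := aff_real_reflection Ta (aff_real_finite bR).
rewrite !mulr0 !subr0 ipairNl ipairNr !scaleNr !opprK /aff_real_down.
rewrite rlength_refl // coroot_reflE // /corefl /refl !opprB.
by rewrite ![- _ + _]addrC.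
Qed.

(** This is the affine simple root, because $r_\theta=1$. *)
Lemma aff_real_down_highest : aff_real_down theta.
Proof.
have := aff_real_simple ord0; rewrite /aff_root /aff_coroot unlift_none /=.
rewrite /aff_real_down (rlength_highest theta_high B_norm).
by rewrite (rmorph1 (@ratr K)).
Qed.

(* -a^ + r delta is the image of -a^ + r theta^, the coroot of theta - a,    *)
(* under the reflection in the affine simple root.                           *)
Lemma aff_real_down_adjacent a : a \in Phi -> ipair (co theta) a = 1 ->
  aff_real_down a.
Proof.
move=> aR a1; have [tR _] := theta_high; set m := ipair (co a) theta.
have bR : theta - a \in Phi.
  by have := opp_root (refl_root tR aR); rewrite /refl a1 scale1r opprB.
have bE : co (theta - a) = - co a + m *: co theta.
  have -> : theta - a = refl D theta (- a).
    by rewrite /refl ipairNr a1 scaleN1r opprK addrC.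
  rewrite coroot_reflE ?opp_root // coroot_opp // /corefl ipairNl.
  by rewrite scaleNr opprK.
have := aff_real_reflection (aff_real_finite bR) aff_real_down_highest.
have -> : ipair (co (theta - a)) (- theta) = - m.
  rewrite bE ipairDl ipairNl ipairZl !ipairNr coroot_root // -/m; ring.
have -> : ipair (- co theta) (theta - a) = -1.
  by rewrite ipairNl ipairDr ipairNr coroot_root // a1.
rewrite (rlength_highest theta_high B_norm) /aff_real_down.
rewrite (rlength_ipair theta_high B_norm) // -/m bE ratr_int.
rewrite (rmorph1 (@ratr K)).
rewrite scaleNr scalerN opprK addrK !rmorphN /= !mulr1 !sub0r !opprK.
by rewrite scaleN1r opprK addrAC subrr add0r.
Qed.

Lemma aff_real_downT a : a \in Phi -> aff_real_down a.
Proof.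
move=> aR; have [tR _] := theta_high.
have [c ac c0] := weyl_orbit_pos aR tR.
have cR := weyl_orbit_root aR ac.
apply: (weyl_orbit_ind_rev _ aR ac).
  by move=> b c' bR c'R; exact: aff_real_down_refl.
have [->|c1] := highest_ipair theta_high cR c0.
  exact: aff_real_down_highest.
exact: aff_real_down_adjacent.
Qed.

Lemma weight_vector_ext (mu nu : dcartan K n -> K) (v : V) : mu =1 nu ->
  weight_vector g mu v -> weight_vector g nu v.
Proof. by move=> E [v0 vt]; split=> // t; rewrite -E vt. Qed.

Lemma aff_real_string y r x s (mu : dweight K n) (v : V) e p k :
  aff_real y r x s ->
  root_vector g (weval ((map_mx intr y, 0, r) : dweight K n)) e ->
  weight_vector g (weval mu) v ->
  weval mu ((map_mx intr x, s, 0) : dcartan K n) = - p%:R -> (k <= p)%N ->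
  weight_vector g
    (weval (mu + k%:R *: ((map_mx intr y, 0, r) : dweight K n)))
    (iter k (lact e) v).
Proof.
move=> T he hv mup kp.
apply: weight_vector_ext (real_root_string T he hv mup kp).
by move=> t; rewrite wevalD wevalZ.
Qed.

(** The $\check\delta$ coefficient pairs to zero with every coroot involved, so it is left
    unspecified. *)
Lemma varpiE (Bco : 'M[rat]_n) kappa (x : 'rV[int]_n) : exists r,
  varpi K Bco kappa x = (map_mx intr (- x), 1, r).
Proof.
eexists; rewrite /varpi; set q := ratr _.
transitivity ((0 - map_mx intr x - q *: 0, 1 - 0 - q * 0, 0 - 0 - q * 1) :
    dweight K n) => //.
by rewrite scaler0 mulr0 !subr0 sub0r map_mxN.
Qed.

End AffineRealRoots.

(** * Powers of real root vectors on extremal vectors *)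

Local Open Scope complex_scope.

Theorem lemma3p12
  (R : realType)
  (n : nat) (D : rootDatum n)
  (theta : 'rV[int]_n) (theta_highest : highest_root D theta)
  (B : 'M[rat]_n) (B_norm : normalized_root_form D B)
  (Bco : 'M[rat]_n) (Bco_norm : normalized_coweight_form D theta Bco)
  (g : kacMoody (dual_affine D R[i] theta))
  (kappa : 'I_n.+1) (kappa_M : kac_label theta kappa = 1)
  (H : lieModule g)
  (H_irr : irreducible_module H)
  (H_int : integrable_module g H)
  (H_hw : highest_weight_module g H
            (weval (Lambda0 R[i] n + fin_weight R[i] (fund_coweight kappa))))
  (lambda : 'rV[int]_n) (lambda_kappa : in_coroot_coset D kappa lambda)
  (v : H) (v_wt : weight_vector g (weval (varpi R[i] Bco kappa lambda)) v)
  (alpha : 'rV[int]_n) (alpha_pos : is_pos_root D alpha) :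
  (0 < ipair lambda alpha ->
   forall e : g, root_vector g (weval (fin_weight R[i] (coroot D alpha))) e ->
   forall k : nat, (0 < k)%N -> k%:Z <= ipair lambda alpha ->
     iter k (lact e) v != 0 /\
     exists mu : dweight R[i] n,
       weight_vector g (weval mu) (iter k (lact e) v) /\
       pweight mu = map_mx intr (lambda - k%:Z *: coroot D alpha))
  /\
  (ipair lambda alpha < -1 ->
   forall e : g,
     root_vector g (weval (- fin_weight R[i] (coroot D alpha)
                         + ratr (rlength B alpha) *: ddelta R[i] n)) e ->
   forall k : nat, (0 < k)%N -> k%:Z < - ipair lambda alpha ->
     iter k (lact e) v != 0 /\
     exists mu : dweight R[i] n,
       weight_vector g (weval mu) (iter k (lact e) v) /\
       pweight mu = map_mx intr (lambda + k%:Z *: coroot D alpha)).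
Proof.
have [r mu0E] := varpiE R[i] Bco kappa lambda.
rewrite mu0E in v_wt; have [alphaR _] := alpha_pos.
split=> [l_gt0|l_lt] e he k k_gt0 kl.
  (* The coroot $\alpha$ has no central part, so the level does not enter and
     $p=\langle\lambda,\alpha\rangle$. *)
  have mup : weval ((map_mx intr (- lambda), 1, r) : dweight R[i] n)
      ((map_mx intr alpha, 0, 0) : dcartan R[i] n) =
      - (absz (ipair lambda alpha))%:R.
    rewrite weval_fin mulr0 addr0 ipairNl rmorphN /=; congr (- _).
    by rewrite -[in LHS](gtz0_abs l_gt0).
  have T := aff_real_finite theta_highest H_int alphaR.
  have kp : (k <= absz (ipair lambda alpha))%N by lia.
  have W := aff_real_string T he v_wt mup kp.
  split; first by case: W.
  eexists; split; first exact: W.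
  by rewrite /pweight /= map_mxB map_mxZ map_mxN opprD opprK.
(* Here the central part of the coroot contributes the level $1$, so
   $p=-\langle\lambda,\alpha\rangle-1$; this is why the bound on $k$ is strict. *)
have mup : weval ((map_mx intr (- lambda), 1, r) : dweight R[i] n)
    ((map_mx intr (- alpha), 1, 0) : dcartan R[i] n) =
    - (absz (ipair lambda alpha + 1))%:R.
  rewrite weval_fin mulr1 ipairNl ipairNr opprK.
  rewrite -[1 in LHS]/(1%:~R) -rmorphD /= pmulrn -rmorphN /=; congr (_%:~R).
  by lia.
have T := aff_real_downT theta_highest H_int B_norm alphaR.
have eE : - fin_weight R[i] (coroot D alpha) +
    ratr (rlength B alpha) *: ddelta R[i] n =
    (map_mx intr (- coroot D alpha), 0, ratr (rlength B alpha)).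
  set q := ratr _.
  transitivity ((- map_mx intr (coroot D alpha) + q *: 0, - 0 + q * 0,
    - 0 + q * 1) : dweight R[i] n) => //.
  by rewrite scaler0 mulr0 mulr1 oppr0 !addr0 add0r map_mxN.
rewrite eE in he.
have kp : (k <= absz (ipair lambda alpha + 1)%R)%N by lia.
have W := aff_real_string T he v_wt mup kp.
split; first by case: W.
eexists; split; first exact: W.
by rewrite /pweight /= map_mxD map_mxZ !map_mxN opprD scalerN !opprK.
Qed.
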